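(* Let $t \geq 1$. For simple graphs $G$ and $H$ (with non-empty vertex sets), the following are equivalent: 1. the level-$t$ Lasserre relaxation for graph isomorphism of $G$ and $H$ is feasible; 2. $G$ and $H$ are level-$t$ $\mathcal{PSD}$-isomorphic; 3. there is a level-$t$ $\mathcal{PSD}$-isomorphism map from $G$ to $H$; 4. $G$ and $H$ are partially $t$-equivalent; 5. $G$ and $H$ are homomorphism indistinguishable over $\mathcal{L}_t$.
   Context: Graphs are finite, undirected, without multiple edges, and may have loops; simple means loopless. A homomorphism $F\to G$ is a map $V(F)\to V(G)$ sending edges to edges (looped vertices to looped vertices); $\hom(F,G)$ is the number of homomorphisms. Bilabelled graphs. A $(t,t)$-bilabelled graph is a tuple $\boldsymbol{F}=(F,\boldsymbol{u},\boldsymbol{v})$ with $F$ a graph and $\boldsymbol{u},\boldsymbol{v}\in V(F)^t$ (in-labels, out-labels; repetitions allowed). Bilabelled graphs are considered up to isomorphism. Its homomorphism tensor for a graph $G$ is $\boldsymbol{F}_G\in\mathbb{C}^{V(G)^t\times V(G)^t}$ whose $(\boldsymbol{x},\boldsymbol{y})$-entry is the number of homomorphisms $h:F\to G$ with $h(\boldsymbol{u}_i)=\boldsymbol{x}_i$ and $h(\boldsymbol{v}_i)=\boldsymbol{y}_i$ for all $i \in [t]$. $\operatorname{soe}(\boldsymbol{F}) := F$ is the underlying unlabelled graph. For $\sigma\in\mathfrak{S}_{2t}$ (symmetric group), $\boldsymbol{F}^\sigma := (F,\boldsymbol{x},\boldsymbol{y})$ where the concatenation $\boldsymbol{x}\boldsymbol{y}$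 has $i$-th entry $(\boldsymbol{u}\boldsymbol{v})_{\sigma(i)}$, $i\in[2t]$. The series composition $\boldsymbol{F}\cdot\boldsymbol{F}'$ of $\boldsymbol{F}=(F,\boldsymbol{u},\boldsymbol{v})$ and $\boldsymbol{F}'=(F',\boldsymbol{u}',\boldsymbol{v}')$ is obtained from the disjoint union of $F$ and $F'$ by identifying $\boldsymbol{v}_i$ with $\boldsymbol{u}'_i$ for all $i$, with in-labels $\boldsymbol{u}$ and out-labels $\boldsymbol{v}'$. The parallel composition $\boldsymbol{F}\odot\boldsymbol{F}'$ is obtained by identifying $\boldsymbol{u}_i$ with $\boldsymbol{u}'_i$ and $\boldsymbol{v}_i$ with $\boldsymbol{v}'_i$ for all $i$, with in-labels $\boldsymbol{u}$ and out-labels $\boldsymbol{v}$. In both cases multiple edges are removed and loops are kept. A $(t,t)$-bilabelled graph is atomic if all its vertices are labelled; $\mathcal{A}_t$ is the set of atomic $(t,t)$-bilabelled graphs. The class $\mathcal{L}_t$ is the class of $(t,t)$-bilabelled graphs generated by $\mathcal{A}_t$ under parallel composition with graphs from $\mathcal{A}_t$, series composition, and the action $\boldsymbol{F} \mapsto \boldsymbol{F}^\sigma$ of $\mathfrak{S}_{2t}$. $G$ and $H$ are homomorphism indistinguishable over $\mathcal{L}_t$ if $\hom(\operatorname{soe}(\boldsymbol{F}),G)=\hom(\operatorname{soe}(\boldsymbol{F}),H)$ for all $\boldsymbol{F}\in\mathcal{L}_t$. Atomic types. For $g_1,\dots,g_\ell \in V(G)$ and $h_1,\dots,h_\ell\in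 V(H)$ write $\mathrm{atp}_G(g_1,\dots,g_\ell)=\mathrm{atp}_H(h_1,\dots,h_\ell)$ if for all $i,j$: $g_i=g_j\Leftrightarrow h_i=h_j$ and $g_ig_j\in E(G)\Leftrightarrow h_ih_j\in E(H)$; then $\{g_1h_1,\dots,g_\ell h_\ell\}\subseteq V(G)\times V(H)$ is called a partial isomorphism ($gh$ denotes the pair $(g,h)$). Level-$t$ Lasserre relaxation. Real variables $y_I$, $I \in \binom{V(G)\times V(H)}{\leq 2t}$ (subsets of size at most $2t$), with constraints: $(y_{I\cup J})_{I,J\in\binom{V(G)\times V(H)}{\leq t}}$ is positive semidefinite; $\sum_{h\in V(H)} y_{I\cup\{gh\}} = y_I$ for all $|I| \leq 2t-2$, $g\in V(G)$; $\sum_{g\in V(G)} y_{I\cup\{gh\}} = y_I$ for all $|I|\leq 2t-2$, $h\in V(H)$; $y_I=0$ if $I$ is not a partial isomorphism; $y_\emptyset=1$. Level-$t$ $\mathcal{K}$-isomorphic. Let $\mathcal{PSD}$ be the family of real positive semidefinite matrices. For a family of matrices $\mathcal{K}$, $G$ and $H$ are level-$t$ $\mathcal{K}$-isomorphic if there is $M\in\mathcal{K}$ with rows and columns indexed by $(V(G)\times V(H))^t$ such that, writing $M[g_1h_1\dots g_{2t}h_{2t}] := M_{g_1h_1\dots g_th_t,\,g_{t+1}h_{t+1}\dots g_{2t}h_{2t}}$, for all $g_1,\dots,g_{2t}\in V(G)$, $h_1,\dots,h_{2t}\in V(H)$: (a) for every $i\in[2t]$, $\sum_{g_i\in V(G)}M[g_1h_1\dots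 g_{2t}h_{2t}]=\sum_{h_i\in V(H)}M[g_1h_1\dots g_{2t}h_{2t}]$; (b) $\sum_{g_1,\dots,g_{2t}\in V(G)}M[g_1h_1\dots g_{2t}h_{2t}]=1=\sum_{h_1,\dots,h_{2t}\in V(H)}M[g_1h_1\dots g_{2t}h_{2t}]$; (c) $M[g_1h_1\dots g_{2t}h_{2t}]=0$ if $\mathrm{atp}_G(g_1,\dots,g_{2t})\neq\mathrm{atp}_H(h_1,\dots,h_{2t})$; (d) $M[g_1h_1\dots g_{2t}h_{2t}]=M[g_{\sigma(1)}h_{\sigma(1)}\dots g_{\sigma(2t)}h_{\sigma(2t)}]$ for all $\sigma\in\mathfrak{S}_{2t}$. Tensor action. For $A\in\mathbb{C}^{V(G)^t\times V(G)^t}$ and $\sigma\in\mathfrak{S}_{2t}$, $A^\sigma(\boldsymbol{u},\boldsymbol{v}) := A(\boldsymbol{x},\boldsymbol{y})$ where $(\boldsymbol{x}\boldsymbol{y})_i=(\boldsymbol{u}\boldsymbol{v})_{\sigma^{-1}(i)}$ for $i\in[2t]$. $\odot$ on matrices is the entrywise (Schur) product; $J$ is the all-ones and $I$ the identity matrix; $*$ on matrices is the conjugate transpose. Level-$t$ $\mathcal{K}$-isomorphism map from $G$ to $H$. A linear map $\Phi:\mathbb{C}^{V(G)^t\times V(G)^t}\to\mathbb{C}^{V(H)^t\times V(H)^t}$ such that: $\Phi$ is completely $\mathcal{K}$-preserving (i.e. for all $r\in\mathbb{N}$, $\mathrm{id}_r\otimes\Phi$ maps matrices in $\mathcal{K}$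 to matrices in $\mathcal{K}$); $\Phi(\boldsymbol{A}_G\odot X)=\boldsymbol{A}_H\odot\Phi(X)$ for all $\boldsymbol{A}\in\mathcal{A}_t$ and all $X$; $\Phi(J)=J=\Phi^*(J)$, where $\Phi^*$ is the adjoint of $\Phi$ with respect to $\langle A,B\rangle=\operatorname{tr}(AB^* )$; $\Phi(X^\sigma)=\Phi(X)^\sigma$ for all $\sigma\in\mathfrak{S}_{2t}$ and all $X$. Partial $t$-equivalence. The $t$-partially coherent algebra $\widehat{\mathcal{A}}^t_G$ is the smallest linear subspace of $\mathbb{C}^{V(G)^t\times V(G)^t}$ closed under matrix multiplication and conjugate transposes, containing $I$ and $J$, closed under Schur product with $\boldsymbol{A}_G$ for every $\boldsymbol{A}\in\mathcal{A}_t$, and closed under $A\mapsto A^\sigma$ for all $\sigma\in\mathfrak{S}_{2t}$. $G$ and $H$ are partially $t$-equivalent if $|V(G)|=|V(H)|$ and there is a vector space isomorphism $\phi:\widehat{\mathcal{A}}^t_G\to\widehat{\mathcal{A}}^t_H$ such that for all $M,N\in\widehat{\mathcal{A}}^t_G$, $\boldsymbol{A}\in\mathcal{A}_t$, $\sigma\in\mathfrak{S}_{2t}$: $\phi(M^* )=\phi(M)^*$; $\phi(MN)=\phi(M)\phi(N)$; $\phi(I)=I$, $\phi(\boldsymbol{A}_G)=\boldsymbol{A}_H$, $\phi(J)=J$; $\phi(\boldsymbol{A}_G\odot M)=\boldsymbol{A}_H\odot\phi(M)$; $\phi(M^\sigma)=\phi(M)^\sigma$. *)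

(* Defs.v *)
From HB Require Import structures.
From mathcomp Require Import classical_sets functions reals.
From mathcomp Require Import all_boot all_order all_fingroup all_algebra.
From mathcomp Require Import complex mxtens.

Set Implicit Arguments.
Unset Strict Implicit.
Unset Printing Implicit Defensive.

Import GRing.Theory Num.Theory.
Local Open Scope ring_scope.
Local Open Scope sesquilinear_scope.
Local Open Scope quotient_scope.

(* Loops are allowed; [edge] being a relation rules out multiple edges. *)
Record graph := Graph {
  vertex :> finType;
  edge : rel vertex;
  edge_sym : symmetric edge }.

Definition simple (G : graph) : Prop := irreflexive (@edge G).

Definition is_hom (F G : graph) (f : {ffun F -> G}) : bool :=
  [forall x, forall y, edge x y ==> edge (f x) (f y)].

Definition hom (F G : graph) : nat := #|[pred f : {ffun F -> G} | is_hom f]|.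

(* Pairs of labels in [T^t x T^t] are identified with words of length
   [t + t = 2t]. *)
Section Words.
Variables (t : nat) (T : finType).

Definition wcat (u v : {ffun 'I_t -> T}) : {ffun 'I_(t + t) -> T} :=
  [ffun i => match fintype.split i with inl j => u j | inr j => v j end].

Definition wleft (w : {ffun 'I_(t + t) -> T}) : {ffun 'I_t -> T} :=
  [ffun i => w (lshift t i)].

Definition wright (w : {ffun 'I_(t + t) -> T}) : {ffun 'I_t -> T} :=
  [ffun i => w (rshift t i)].

Definition wperm (s : 'S_(t + t)) (w : {ffun 'I_(t + t) -> T}) :
    {ffun 'I_(t + t) -> T} :=
  [ffun i => w (s i)].

End Words.

Record bigraph (t : nat) := BiGraph {
  soe :> graph;
  inlab : {ffun 'I_t -> soe};
  outlab : {ffun 'I_t -> soe} }.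

Definition bigraph_iso t (F F' : bigraph t) : Prop :=
  exists f : F -> F',
    [/\ bijective f,
        forall x y, edge (f x) (f y) = edge x y,
        forall i, f (inlab F i) = inlab F' i
      & forall i, f (outlab F i) = outlab F' i].

Definition atomic t (F : bigraph t) : Prop :=
  forall x : F, (exists i, inlab F i = x) \/ (exists i, outlab F i = x).

Definition bigraph_perm t (F : bigraph t) (s : 'S_(t + t)) : bigraph t :=
  let w := wperm s (wcat (inlab F) (outlab F)) in
  BiGraph (wleft w) (wright w).

Section Glue.
Variables (F : graph) (r : rel F).

(* The least equivalence relation containing [r]. *)
Definition glue_rel : rel F := connect (fun x y => r x y || r y x).

Lemma glue_rel_sym : symmetric glue_rel.
Proof. by apply: sym_connect_sym => x y; rewrite orbC. Qed.

Canonical glue_equiv : equiv_rel F :=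
  EquivRel glue_rel (fun x => connect0 _ x) glue_rel_sym
    (fun y x z => @connect_trans _ _ y x z).

Definition glue_vertex : Type := {eq_quot glue_equiv}.
HB.instance Definition _ := EqQuotient.on glue_vertex.
HB.instance Definition _ := Choice.on glue_vertex.
HB.instance Definition _ : isCountable glue_vertex :=
  CanIsCountable (@reprK _ {eq_quot glue_equiv}).
HB.instance Definition _ : isFinite glue_vertex :=
  CanIsFinite (@reprK _ {eq_quot glue_equiv}).

Definition glue_proj (x : F) : glue_vertex := \pi_{eq_quot glue_equiv} x.

Definition glue_edge : rel glue_vertex := fun a b =>
  [exists x, exists y, [&& glue_proj x == a, glue_proj y == b & edge x y]].

Lemma glue_edge_sym : symmetric glue_edge.
Proof.
by move=> a b; apply/existsP/existsP => -[x /existsP[y /and3P[xa yb xy]]];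
  exists y; apply/existsP; exists x; rewrite yb xa edge_sym.
Qed.

Definition glue : graph := Graph glue_edge_sym.

Lemma glue_projP (x y : F) : reflect (glue_proj x = glue_proj y) (glue_rel x y).
Proof. by apply: (iffP idP) => [/eqmodP|/eqmodP]. Qed.

End Glue.

Section DisjointUnion.
Variables F F' : graph.

Definition sum_edge : rel (F + F')%type := fun x y =>
  match x, y with
  | inl a, inl b => edge a b
  | inr a, inr b => edge a b
  | _, _ => false
  end.

Lemma sum_edge_sym : symmetric sum_edge.
Proof. by case=> a [] b //=; rewrite edge_sym. Qed.

Definition graph_sum : graph := Graph sum_edge_sym.

End DisjointUnion.

Section Compositions.
Variables (t : nat) (F F' : bigraph t).

Definition series_rel : rel (graph_sum F F') := fun x y =>
  [exists i, (x == inl (outlab F i)) && (y == inr (inlab F' i))].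

Definition series : bigraph t :=
  @BiGraph t (glue series_rel)
    [ffun i => glue_proj series_rel (inl (inlab F i))]
    [ffun i => glue_proj series_rel (inr (outlab F' i))].

Definition parallel_rel : rel (graph_sum F F') := fun x y =>
  [exists i, (x == inl (inlab F i)) && (y == inr (inlab F' i))
          || (x == inl (outlab F i)) && (y == inr (outlab F' i))].

Definition parallel : bigraph t :=
  @BiGraph t (glue parallel_rel)
    [ffun i => glue_proj parallel_rel (inl (inlab F i))]
    [ffun i => glue_proj parallel_rel (inl (outlab F i))].

End Compositions.

(* [Lclass_iso]: bilabelled graphs are considered up to isomorphism. *)
Inductive Lclass (t : nat) : bigraph t -> Prop :=
| Lclass_atomic F : atomic F -> Lclass F
| Lclass_parallel F A : Lclass F -> atomic A -> Lclass (parallel F A)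
| Lclass_series F F' : Lclass F -> Lclass F' -> Lclass (series F F')
| Lclass_perm F s : Lclass F -> Lclass (bigraph_perm F s)
| Lclass_iso F F' : bigraph_iso F F' -> Lclass F -> Lclass F'.

Definition hom_indist t (G H : graph) : Prop :=
  forall F : bigraph t, Lclass F -> hom (soe F) G = hom (soe F) H.

(* Matrices indexed by a finite type [T] have type ['M_#|T|]. *)
Definition mxat (C : Type) (T : finType) (A : 'M[C]_#|T|) (x y : T) : C :=
  A (enum_rank x) (enum_rank y).

Definition mxof (C : Type) (T : finType) (f : T -> T -> C) : 'M[C]_#|T| :=
  \matrix_(i, j) f (enum_val i) (enum_val j).

Definition schurmx (C : pzRingType) m n (A B : 'M[C]_(m, n)) : 'M[C]_(m, n) :=
  map2_mx *%R A B.

Notation "A \odot B" := (schurmx A B)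
  (at level 40, left associativity) : ring_scope.

Notation tensor C t G := 'M[C]_#|{ffun 'I_t -> Finite.sort (vertex G)}|.

Section Tensors.
Variables (C : pzRingType) (t : nat).

Definition homtensor (F : bigraph t) (G : graph) : tensor C t G :=
  mxof (fun x y : {ffun 'I_t -> G} =>
    #|[pred h : {ffun F -> G} |
        [&& is_hom h, [forall i, h (inlab F i) == x i]
          & [forall i, h (outlab F i) == y i]]]|%:R).

Definition tensor_perm (G : graph) (s : 'S_(t + t)) (A : tensor C t G) :
    tensor C t G :=
  mxof (fun u v : {ffun 'I_t -> G} =>
    let w := wperm s^-1%g (wcat u v) in mxat A (wleft w) (wright w)).

End Tensors.

Definition psdmx (R : realType) n (M : 'M[R]_n) : Prop :=
  M^T = M /\ forall x : 'rV[R]_n, 0 <= (x *m M *m x^T) 0 0.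

Definition mxfamily (R : realType) := forall n, 'M[R[i]]_n -> Prop.

(* The family of real positive semidefinite matrices, inside the complex
   ones. *)
Definition PSD (R : realType) : mxfamily R := fun n A =>
  exists2 M : 'M[R]_n, psdmx M & A = map_mx (real_complex R) M.
Arguments PSD : clear implicits.

Definition same_atp (G H : graph) l (g : 'I_l -> G) (h : 'I_l -> H) : bool :=
  [forall i, forall j, ((g i == g j) == (h i == h j))
                    && (edge (g i) (g j) == edge (h i) (h j))].

Definition partial_iso (G H : graph) (I : {set G * H}) : Prop :=
  exists l (g : 'I_l -> G) (h : 'I_l -> H),
    same_atp g h /\ I = [set (g i, h i) | i : 'I_l].

(* Only the values of [y] on sets of size at most [2 * t] are variables of the
   relaxation; the other ones are unconstrained. *)
Record lasserre (R : realType) t (G H : graph) (y : {set G * H} -> R) : Prop := {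
  lasserre_psd :
    psdmx (\matrix_(i, j < #|[set I : {set G * H} | #|I| <= t]%N|)
             y (enum_val i :|: enum_val j));
  lasserre_sumr : forall (I : {set G * H}) (g : G), (#|I| <= 2 * t - 2)%N ->
    \sum_(h : H) y (I :|: [set (g, h)]) = y I;
  lasserre_suml : forall (I : {set G * H}) (h : H), (#|I| <= 2 * t - 2)%N ->
    \sum_(g : G) y (I :|: [set (g, h)]) = y I;
  lasserre_piso : forall I : {set G * H}, (#|I| <= 2 * t)%N ->
    ~ partial_iso I -> y I = 0;
  lasserre_0 : y set0 = 1 }.

Definition lasserre_feasible (R : realType) t (G H : graph) : Prop :=
  exists y : {set G * H} -> R, lasserre t y.

(* The entry [M[g_1 h_1 ... g_2t h_2t]], where the first [t] pairs index the row
   and the last [t] ones the column. *)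
Definition entry (C : Type) t (G H : graph)
    (M : 'M[C]_#|{ffun 'I_t -> (G * H)%type}|)
    (g : {ffun 'I_(t + t) -> G}) (h : {ffun 'I_(t + t) -> H}) : C :=
  let w := [ffun i => (g i, h i)] in mxat M (wleft w) (wright w).

Definition upd (T : Type) n (g : {ffun 'I_n -> T}) (i : 'I_n) (a : T) :
    {ffun 'I_n -> T} :=
  [ffun j => if j == i then a else g j].

Record iso_matrix (C : pzRingType) t (G H : graph)
    (M : 'M[C]_#|{ffun 'I_t -> (G * H)%type}|) : Prop := {
  iso_matrix_sum : forall (g : {ffun 'I_(t + t) -> G}) (h : {ffun 'I_(t + t) -> H})
      (i : 'I_(t + t)),
    \sum_(a : G) entry M (upd g i a) h = \sum_(b : H) entry M g (upd h i b);
  iso_matrix_suml : forall h, \sum_g entry M g h = 1;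
  iso_matrix_sumr : forall g, \sum_h entry M g h = 1;
  iso_matrix_atp : forall (g : {ffun 'I_(t + t) -> G}) (h : {ffun 'I_(t + t) -> H}),
    ~~ same_atp g h -> entry M g h = 0;
  iso_matrix_perm : forall (g : {ffun 'I_(t + t) -> G}) (h : {ffun 'I_(t + t) -> H})
      (s : 'S_(t + t)),
    entry M g h = entry M (wperm s g) (wperm s h) }.

Definition level_isomorphic (R : realType) (K : mxfamily R) t (G H : graph) :
    Prop :=
  exists M : 'M[R[i]]_#|{ffun 'I_t -> (G * H)%type}|, K _ M /\ iso_matrix M.

Section LinearMaps.
Variables (C : numClosedFieldType) (m n : nat).
Variable Phi : {linear 'M[C]_m -> 'M[C]_n}.

Definition mxdot p (A B : 'M[C]_p) : C := \tr (A *m B ^t*).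

Definition adjoint (B : 'M[C]_n) : 'M[C]_m :=
  \matrix_(i, j) mxdot B (Phi (delta_mx i j)).

Lemma adjointP (A : 'M[C]_m) (B : 'M[C]_n) :
  mxdot (Phi A) B = mxdot A (adjoint B).
Proof.
have mxdotE p (X Y : 'M[C]_p) : mxdot X Y = \sum_i \sum_j X i j * (Y i j)^*.
  by apply: eq_bigr => i _; rewrite mxE; apply: eq_bigr => j _; rewrite !mxE.
rewrite [in RHS]mxdotE {1}[A]matrix_sum_delta linear_sum /mxdot mulmx_suml.
rewrite linear_sum; apply: eq_bigr => i _.
rewrite linear_sum /= mulmx_suml linear_sum; apply: eq_bigr => j _ /=.
rewrite linearZ /= -scalemxAl linearZ /= mxE -!/(mxdot _ _) !mxdotE; congr (_ * _).
rewrite rmorph_sum; apply: eq_bigr => k _; rewrite rmorph_sum.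
by apply: eq_bigr => l _; rewrite rmorphM /= conjCK mulrC.
Qed.

(* [id_r (x) Phi], where [X] is the sum of the [E_ij (x) X_ij] over its
   [m]-by-[m] blocks [X_ij]. *)
Definition id_tens r (X : 'M[C]_(r * m)) : 'M[C]_(r * n) :=
  \sum_(i < r) \sum_(j < r)
    delta_mx i j *t
      Phi (\matrix_(k, l) X (mxtens_index (i, k)) (mxtens_index (j, l))).

Lemma id_tensE r (A : 'M[C]_r) (B : 'M[C]_m) :
  id_tens (A *t B) = A *t Phi B.
Proof.
have blockE i j :
    \matrix_(k, l) (A *t B) (mxtens_index (i, k)) (mxtens_index (j, l)) =
    A i j *: B.
  by apply/matrixP => k l; rewrite !mxE !mxtens_indexK.
rewrite /id_tens.
under eq_bigr => i _ do under eq_bigr => j _ do rewrite blockE linearZ.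
apply/matrixP => k l; rewrite summxE [RHS]mxE.
rewrite (bigD1 (mxtens_unindex k).1) //= [X in _ + X]big1 => [|i nik]; last first.
  rewrite summxE big1 // => j _; rewrite !mxE eq_sym (negPf nik).
  by rewrite mul0r.
rewrite addr0 summxE (bigD1 (mxtens_unindex l).1) //= [X in _ + X]big1.
  by rewrite addr0 !mxE !eqxx mul1r.
by move=> j nj; rewrite !mxE eqxx (eq_sym _ j) (negPf nj) mul0r.
Qed.

End LinearMaps.

Definition completely_preserving (R : realType) (K : mxfamily R) m n
    (Phi : {linear 'M[R[i]]_m -> 'M[R[i]]_n}) : Prop :=
  forall r (X : 'M[R[i]]_(r * m)), K _ X -> K _ (id_tens Phi X).

Record isomorphism_map (R : realType) (K : mxfamily R) t (G H : graph)
    (Phi : {linear tensor R[i] t G -> tensor R[i] t H}) : Prop := {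
  isomorphism_map_K : completely_preserving K Phi;
  isomorphism_map_schur : forall (A : bigraph t) X, atomic A ->
    Phi (homtensor R[i] A G \odot X) = homtensor R[i] A H \odot Phi X;
  isomorphism_map_J : Phi (const_mx 1) = const_mx 1;
  isomorphism_map_adjJ : adjoint Phi (const_mx 1) = const_mx 1;
  isomorphism_map_perm : forall (s : 'S_(t + t)) X,
    Phi (tensor_perm s X) = tensor_perm s (Phi X) }.

Record pcoh_closed (C : numClosedFieldType) t (G : graph)
    (S : set (tensor C t G)) : Prop := {
  pcoh_lin : forall a M N, S M -> S N -> S (a *: M + N);
  pcoh_mul : forall M N, S M -> S N -> S (M *m N);
  pcoh_adj : forall M, S M -> S (M ^t*);
  pcoh_I : S 1%:M;
  pcoh_J : S (const_mx 1);
  pcoh_schur : forall (A : bigraph t) M, atomic A -> S M ->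
    S (homtensor C A G \odot M);
  pcoh_perm : forall (s : 'S_(t + t)) M, S M -> S (tensor_perm s M) }.

Definition pcoh_algebra (C : numClosedFieldType) t (G : graph) :
    set (tensor C t G) :=
  smallest (@pcoh_closed C t G) classical_sets.set0.

(* [phi] only matters on the partially coherent algebra of [G]. *)
Record pcoh_iso (C : numClosedFieldType) t (G H : graph)
    (phi : tensor C t G -> tensor C t H) : Prop := {
  pcoh_iso_bij :
    set_bij (@pcoh_algebra C t G) (@pcoh_algebra C t H) phi;
  pcoh_iso_lin : forall a M N, pcoh_algebra M -> pcoh_algebra N ->
    phi (a *: M + N) = a *: phi M + phi N;
  pcoh_iso_adj : forall M, pcoh_algebra M -> phi (M ^t*) = (phi M) ^t*;
  pcoh_iso_mul : forall M N, pcoh_algebra M -> pcoh_algebra N ->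
    phi (M *m N) = phi M *m phi N;
  pcoh_iso_I : phi 1%:M = 1%:M;
  pcoh_iso_A : forall A : bigraph t, atomic A ->
    phi (homtensor C A G) = homtensor C A H;
  pcoh_iso_J : phi (const_mx 1) = const_mx 1;
  pcoh_iso_schur : forall (A : bigraph t) M, atomic A -> pcoh_algebra M ->
    phi (homtensor C A G \odot M) = homtensor C A H \odot phi M;
  pcoh_iso_perm : forall (s : 'S_(t + t)) M, pcoh_algebra M ->
    phi (tensor_perm s M) = tensor_perm s (phi M) }.

Definition partially_equivalent (C : numClosedFieldType) t (G H : graph) :
    Prop :=
  #|G| = #|H| /\ exists phi : tensor C t G -> tensor C t H, pcoh_iso phi.

(* Main.v *)
(** The implications run 1 -> 2 -> 3 -> 4 -> 5 -> 2 -> 1.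

    1 <-> 2: the entry [M[g_1 h_1 ... g_2t h_2t]] is [y_I] for the set [I] of
    the pairs [g_i h_i]; conversely the conditions on [M] force its entries to
    depend on that set only.

    2 -> 3 -> 4: a real factorisation of [M], respectively of the Choi matrix of
    [Phi], gives real Kraus operators, [Phi X = sum_s V_s X V_s^T].  If
    [Phi X = X'] and [Phi^* X' = X], then comparing norms gives
    [V_s X = X' V_s] for all [s].  Hence the pairs [(X, X')] of this kind are
    closed under products, and [Phi] is multiplicative on the partially coherent
    algebra.

    4 -> 5: the isomorphism maps [F_G] to [F_H] for [F] in [L_t], and [J F_G J]
    is [hom(F, G)] times [J].

    5 -> 2: [<F_G, F'_G> = <F_H, F'_H>] for [F], [F'] in [L_t], because this is a
    count of homomorphisms from a graph in [L_t].  So [F_G |-> F_H] extends to an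
    isometry between the spans, whose matrix, reshuffled, is [M].  Every
    self-adjoint operation on [L_t] commutes with this isometry, and this gives
    the equations for [M].  For every vector [z], [M z] read as a matrix
    intertwines [F_G] and [F_H] for all [F], so that the form of [M] at [M z] is
    a sum of squares; as [M] is symmetric this suffices. *)

From HB Require Import structures.
From mathcomp Require Import classical_sets boolp.
From mathcomp Require Import all_order all_fingroup mxtens ring lra zify.
Require Import Defs.
From mathcomp Require Import all_boot all_algebra complex reals.

Set Implicit Arguments.
Unset Strict Implicit.
Unset Printing Implicit Defensive.

Import Order.TTheory GRing.Theory Num.Theory.
Local Open Scope ring_scope.
Local Open Scope sesquilinear_scope.

(** * Real positive semidefinite matrices *)

Lemma submxE (V : zmodType) m n (A B : 'M[V]_(m, n)) i j :
  (A - B) i j = A i j - B i j.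
Proof. by rewrite !mxE. Qed.

(** Nonnegativity of the form at [x - c *: y] is a quadratic inequality in [c]. The form may be
    degenerate, so the coefficient of [c ^+ 2] can vanish. *)
Lemma psdmx_cauchy (R : realType) n (M : 'M[R]_n) (x y : 'rV[R]_n) :
  psdmx M ->
  ((x *m M *m y^T) 0 0) ^+ 2 <= (x *m M *m x^T) 0 0 * (y *m M *m y^T) 0 0.
Proof.
case=> symM posM.
have symxy : (y *m M *m x^T) 0 0 = (x *m M *m y^T) 0 0.
  transitivity ((y *m M *m x^T)^T 0 0); first by rewrite [RHS]mxE.
  by rewrite !trmx_mul trmxK symM mulmxA.
have sq c : 0 <= (x *m M *m x^T) 0 0 - 2 * c * (x *m M *m y^T) 0 0
                 + c ^+ 2 * (y *m M *m y^T) 0 0.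
  have := posM (x - c *: y).
  rewrite [_^T]linearB /= [(_ *: _)^T]linearZ /= !(mulmxBl, mulmxBr).
  rewrite -!(scalemxAl, scalemxAr) => h.
  apply: le_trans h _; rewrite le_eqVlt; apply/orP; left; apply/eqP.
  rewrite !submxE ![(_ *: _ : 'M_(_, _)) _ _]mxE.
  rewrite symxy; ring.
have yy0 := posM y; have xx0 := posM x.
move: ((x *m M *m y^T) 0 0) ((x *m M *m x^T) 0 0) ((y *m M *m y^T) 0 0)
  sq yy0 xx0 => b a d sq d0 a0.
have [d_eq0|d_neq0] := eqVneq d 0.
  have [-> |b0] := eqVneq b 0; first by rewrite expr0n /= mulr_ge0.
  (* For [d = 0] the inequality is affine in [c], and this [c] turns it into [0 <= a - (a + 1)]. *)
  have := sq ((a + 1) / (2 * b)); rewrite d_eq0 mulr0 addr0.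
  have -> : 2 * ((a + 1) / (2 * b)) * b = a + 1.
    by field.
  lra.
have d_gt0 : 0 < d by rewrite lt_def d_neq0.
(* The minimiser of the quadratic. *)
have := sq (b / d).
have -> : a - 2 * (b / d) * b + (b / d) ^+ 2 * d = (a * d - b ^+ 2) / d.
  by field.
by rewrite pmulr_lge0 ?invr_gt0 // subr_ge0.
Qed.

Lemma psdmx_gram (R : realType) k n (B : 'M[R]_(k, n)) : psdmx (B^T *m B).
Proof.
split=> [|x]; first by rewrite trmx_mul trmxK.
have -> : x *m (B^T *m B) *m x^T = (x *m B^T) *m (x *m B^T)^T.
  by rewrite trmx_mul trmxK !mulmxA.
by rewrite mxE sumr_ge0 // => i _; rewrite [_^T _ _]mxE -expr2 sqr_ge0.
Qed.

Lemma psdmxD (R : realType) n (A B : 'M[R]_n) :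
  psdmx A -> psdmx B -> psdmx (A + B).
Proof.
move=> [symA posA] [symB posB]; split=> [|x].
  by rewrite [LHS]linearD /= symA symB.
by rewrite mulmxDr mulmxDl mxE addr_ge0.
Qed.

Lemma psdmx_sum (R : realType) n (I : finType) (F : I -> 'M[R]_n) :
  (forall i, psdmx (F i)) -> psdmx (\sum_i F i).
Proof.
move=> psdF; apply: (big_ind (@psdmx R n)) => //; last exact: psdmxD.
by split=> [|x]; rewrite ?trmx0 // mulmx0 mul0mx mxE.
Qed.

Lemma psdmx_congr (R : realType) m n (Q : 'M[R]_(m, n)) (M : 'M[R]_n) :
  psdmx M -> psdmx (Q *m M *m Q^T).
Proof.
move=> [symM posM]; split=> [|x]; first by rewrite !trmx_mul trmxK symM mulmxA.
by have := posM (x *m Q); rewrite trmx_mul !mulmxA.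
Qed.

Lemma delta_form (R : realType) n (M : 'M[R]_n) i j :
  ((delta_mx 0 i : 'rV_n) *m M *m (delta_mx 0 j : 'rV_n)^T) 0 0 = M i j.
Proof. by rewrite trmx_delta -rowE -colE !mxE. Qed.

(* Cholesky: split off the rank-one part carried by a nonzero diagonal entry. *)
Lemma psdmx_factor (R : realType) n (M : 'M[R]_n) :
  psdmx M -> exists k (B : 'M[R]_(k, n)), M = B^T *m B.
Proof.
have [c] := ubnP #|[pred i | M i i != 0]|; elim: c M => // c IHc M lec psdM.
have [symM posM] := psdM.
(* By Cauchy-Schwarz, a zero on the diagonal forces its whole row to vanish. *)
have diag0 i j : M i i = 0 -> M i j = 0.
  move=> Mii; apply/eqP; rewrite -sqrf_eq0 eq_le sqr_ge0 andbT.
  have := psdmx_cauchy (delta_mx 0 i) (delta_mx 0 j) psdM.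
  by rewrite !delta_form Mii mul0r.
have [/existsP[i Mii]|noi] := boolP [exists i, M i i != 0]; last first.
  exists 0%N, 0; rewrite mulmx0; apply/matrixP => i j.
  by rewrite mxE diag0 //; apply: contraNeq noi => Mii; apply/existsP; exists i.
have Mii_gt0 : 0 < M i i.
  by have := posM (delta_mx 0 i); rewrite delta_form lt_def Mii.
pose v : 'rV[R]_n := (Num.sqrt (M i i))^-1 *: row i M.
have vE j k : (v^T *m v) j k = M i j * M i k / M i i.
  rewrite mxE big_ord1 !mxE mulrACA -expr2 exprVn sqr_sqrtr ?ltW //.
  by rewrite mulrC.
pose N := M - v^T *m v.
(* Positivity of this Schur complement at [x] is Cauchy-Schwarz between [x] and the basis vector
   [i]. *)
have psdN : psdmx N.
  split=> [|x]; first by rewrite linearB /= trmx_mul trmxK symM.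
  have := psdmx_cauchy x (delta_mx 0 i) psdM; rewrite delta_form.
  have xvE : (x *m (v^T *m v) *m x^T) 0 0
      = ((x *m M *m (delta_mx 0 i : 'rV_n)^T) 0 0) ^+ 2 / M i i.
    have -> : x *m M *m (delta_mx 0 i : 'rV_n)^T = Num.sqrt (M i i) *: (x *m v^T).
      rewrite linearZ /= -scalemxAr scalerA divff ?scale1r ?sqrtr_eq0 -?ltNge //.
      by rewrite -mulmxA trmx_delta -colE tr_row symM.
    have -> : x *m (v^T *m v) *m x^T = (x *m v^T) *m (x *m v^T)^T.
      by rewrite trmx_mul trmxK !mulmxA.
    move: (x *m v^T) => p; rewrite !mxE big_ord1 !mxE exprMn sqr_sqrtr ?ltW //.
    by rewrite mulrAC divff // mul1r expr2.
  by rewrite /N mulmxBr mulmxBl submxE xvE subr_ge0 ler_pdivrMr.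
(* The measure drops: the diagonal entry at [i] becomes zero, and zero diagonal entries stay zero
   because their rows vanish. *)
have /IHc [//|k [B NE]] : (#|[pred i | N i i != 0%R]| < c)%N.
  rewrite -ltnS; apply: leq_trans lec; rewrite ltnS.
  apply/proper_card/properP; split.
    apply/subsetP => j; rewrite !inE submxE vE.
    apply: contra_neq => Mjj; have -> : M i j = 0 by rewrite -symM mxE diag0.
    by rewrite Mjj !mul0r subr0.
  exists i; rewrite !inE // negbK submxE vE mulfK // subrr //.
exists (1 + k)%N, (col_mx v B).
by rewrite tr_col_mx mul_row_col -NE /N addrC subrK.
Qed.

(** In a factorisation [M = B^T *m B] the form at [x] is the squared norm of [x *m B^T]. *)
Lemma psdmx_null (R : realType) n (M : 'M[R]_n) (x : 'rV[R]_n) :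
  psdmx M -> (x *m M *m x^T) 0 0 = 0 -> x *m M = 0.
Proof.
move=> /psdmx_factor[k [B ->]].
have -> : x *m (B^T *m B) *m x^T = (x *m B^T) *m (x *m B^T)^T.
  by rewrite trmx_mul trmxK !mulmxA.
rewrite mulmxA mxE; under eq_bigr do rewrite [_^T _ _]mxE -expr2.
move=> /eqP; rewrite psumr_eq0 => [/allP xB0|i _]; last exact: sqr_ge0.
suff -> : x *m B^T = 0 by rewrite mul0mx.
apply/rowP => i; rewrite [RHS]mxE; apply/eqP; rewrite -sqrf_eq0.
exact: (xB0 i (mem_index_enum i)).
Qed.

(** Congruence by the 0-1 matrix whose row [i] is the basis vector [f i]. It is applied to an [f]
    that sends many words to one set. *)
Lemma psdmx_mxsub (R : realType) m n (f : 'I_m -> 'I_n) (M : 'M[R]_n) :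
  psdmx M -> psdmx (mxsub f f M).
Proof.
move=> /(psdmx_congr (rowsub f 1%:M)); congr psdmx.
rewrite -rowsubE; apply/matrixP => i j; rewrite !mxE.
rewrite (bigD1 (f j)) //= !mxE eqxx mulr1 big1 ?addr0 // => k /negPf nk.
by rewrite !mxE eq_sym nk mulr0.
Qed.

Lemma row_sq_eq0 (R : realType) n (v : 'rV[R]_n) : (v *m v^T) 0 0 = 0 -> v = 0.
Proof.
move=> vv; rewrite -[v]mulmx1 -[1%:M]mulmx1.
have psd1 : psdmx (1%:M : 'M[R]_n).
  by have := psdmx_gram (1%:M : 'M[R]_n); rewrite trmx1 mulmx1.
by rewrite mulmx1 (psdmx_null psd1) // mulmx1.
Qed.

(* [N] and [N *m N] have the same row space, so it suffices to test [N] on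
   vectors of the form [z *m N]. *)
Lemma psdmx_cube (R : realType) n (N : 'M[R]_n) : N^T = N ->
  (forall z : 'rV_n, 0 <= (z *m N *m N *m (z *m N)^T) 0 0) -> psdmx N.
Proof.
move=> symN pos; split=> // x.
(* By symmetry, [v *m N *m N *m v^T] is the squared norm of [v *m N]. *)
have kerN (v : 'rV_n) : v *m N *m N = 0 -> v *m N = 0.
  move=> vNN; apply: row_sq_eq0.
  by rewrite trmx_mul symN mulmxA vNN mul0mx mxE.
have kNN : (kermx (N *m N) <= kermx N)%MS.
  apply/rV_subP => v /sub_kermxP; rewrite mulmxA => /kerN vN.
  exact/sub_kermxP.
have /submxP[P NE] : (N <= N *m N)%MS.
  have := mxrankS kNN; rewrite !mxrank_ker => le.
  have leN := rank_leq_row N.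
  rewrite -(geq_leqif (mxrank_leqif_sup (submxMl N N))).
  by rewrite -(leq_sub2lE _ leN).
have xE : x *m N = (x *m P) *m N *m N by rewrite {1}NE !mulmxA.
have := pos (x *m P); rewrite -xE.
suff -> : x *m N *m (x *m P *m N)^T = x *m N *m x^T by [].
have -> : x *m N *m x^T = x *m (x *m N)^T by rewrite trmx_mul symN mulmxA.
by rewrite [in RHS]xE [in RHS]trmx_mul symN mulmxA.
Qed.

(** * Words and homomorphism counts *)

Section Words.
Variables (t : nat) (T : finType).
Implicit Types (u v : {ffun 'I_t -> T}) (w : {ffun 'I_(t + t) -> T}).

Lemma wcatl u v i : wcat u v (lshift t i) = u i.
Proof. by rewrite ffunE -[lshift t i]/(unsplit (inl i)) unsplitK. Qed.

Lemma wcatr u v i : wcat u v (rshift t i) = v i.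
Proof. by rewrite ffunE -[rshift t i]/(unsplit (inr i)) unsplitK. Qed.

Lemma wcatK u v : wleft (wcat u v) = u.
Proof. by apply/ffunP => i; rewrite ffunE wcatl. Qed.

Lemma wcatKr u v : wright (wcat u v) = v.
Proof. by apply/ffunP => i; rewrite ffunE wcatr. Qed.

Lemma wcat_split w : wcat (wleft w) (wright w) = w.
Proof.
by apply/ffunP => i; rewrite -(splitK i); case: fintype.split => j;
  rewrite /= ?wcatl ?wcatr ffunE.
Qed.

Lemma wcat_eq u v u' v' : (wcat u v == wcat u' v') = (u == u') && (v == v').
Proof.
apply/eqP/andP => [e|[/eqP-> /eqP->] //].
have := congr1 (@wleft t T) e; have := congr1 (@wright t T) e.
by rewrite !wcatK !wcatKr => -> ->.
Qed.

Lemma wpermM s s' w : wperm s (wperm s' w) = wperm (s * s')%g w.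
Proof. by apply/ffunP => i; rewrite !ffunE permM. Qed.

Lemma wperm1 w : wperm 1%g w = w.
Proof. by apply/ffunP => i; rewrite ffunE perm1. Qed.

Lemma wpermK s : cancel (@wperm t T s) (wperm s^-1%g).
Proof. by move=> w; rewrite wpermM mulVg wperm1. Qed.

Lemma wpermKV s : cancel (@wperm t T s^-1%g) (wperm s).
Proof. by move=> w; rewrite wpermM mulgV wperm1. Qed.

Lemma sum_words (V : nmodType) (f : {ffun 'I_(t + t) -> T} -> V) :
  \sum_w f w = \sum_u \sum_v f (wcat u v).
Proof.
rewrite pair_big /= (reindex (fun p : _ * _ => wcat p.1 p.2)) //=.
exists (fun w => (wleft w, wright w)) => [[u v] _|w _] /=.
  by rewrite wcatK wcatKr.
exact: wcat_split.
Qed.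

End Words.

Definition pullback (A B : finType) (T : Type) (e : A -> B) (h : {ffun B -> T}) :
  {ffun A -> T} := [ffun i => h (e i)].

Lemma pullbackE (A B : finType) (T : Type) (e : A -> B) (h : {ffun B -> T}) i :
  pullback e h i = h (e i).
Proof. exact: ffunE. Qed.

Lemma is_homP (F G : graph) (f : {ffun F -> G}) :
  reflect (forall x y, edge x y -> edge (f x) (f y)) (is_hom f).
Proof.
apply: (iffP forallP) => h x; first by move=> y; apply/implyP/(forallP (h x)).
by apply/forallP => y; apply/implyP/h.
Qed.

(** Universal property of the quotient: pullback along the projection is a bijection onto the
    homomorphisms that are constant on [r]. The predicate [Q] will carry the label conditions. *)
Lemma hom_glue (F G : graph) (r : rel F) (Q : pred {ffun F -> G}) :
  #|[pred h : {ffun glue r -> G} | is_hom h && Q (pullback (glue_proj r) h)]|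
  = #|[pred f : {ffun F -> G} |
        [&& is_hom f, [forall x, forall y, r x y ==> (f x == f y)] & Q f]]|.
Proof.
have pull_inj : injective (@pullback _ _ G (glue_proj r)).
  move=> h h' e; apply/ffunP => a.
  have := congr1 (fun f : {ffun _} => f (repr a)) e.
  by rewrite !ffunE /glue_proj reprK.
rewrite -(card_image pull_inj); apply: eq_card => f.
apply/imageP/idP => [[h]|].
  rewrite !inE => /andP[/is_homP homh Qh] ->; rewrite Qh andbT.
  apply/andP; split.
    apply/is_homP => x y xy; rewrite !ffunE; apply: homh.
    by apply/existsP; exists x; apply/existsP; exists y; rewrite !eqxx.
  apply/forallP => x; apply/forallP => y; apply/implyP => rxy.
  rewrite !ffunE; apply/eqP; congr (h _); apply/glue_projP.
  by apply: connect1; rewrite rxy.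
rewrite inE => /and3P[/is_homP homf /forallP fr Qf].
(* Constancy along [r] propagates along paths to the generated equivalence. *)
have fglue x y : glue_rel r x y -> f x = f y.
  move=> /connectP[p + ->]; elim: p x => //= z p IHp x /andP[xz /IHp <-].
  case/orP: xz => xz; first by apply/eqP/(implyP (forallP (fr x) z)).
  by apply/esym/eqP/(implyP (forallP (fr z) x)).
pose fr' : {ffun glue r -> G} := [ffun a : glue_vertex r => f (repr a)].
have fr'E x : fr' (glue_proj r x) = f x.
  by rewrite ffunE; apply: fglue; apply/glue_projP; rewrite /glue_proj reprK.
have fE : f = pullback (glue_proj r) fr' by apply/ffunP => x; rewrite ffunE fr'E.
exists fr' => //; rewrite inE -fE Qf andbT.
apply/is_homP => a b /existsP[x /existsP[y /and3P[/eqP<- /eqP<- xy]]].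
by rewrite !fr'E homf.
Qed.

(** [Q] may couple the two halves, so that it can hold the identifications made by either
    composition. *)
Lemma hom_graph_sum (F F' G : graph) (Q : {ffun F -> G} -> {ffun F' -> G} -> bool) :
  #|[pred f : {ffun graph_sum F F' -> G} |
      is_hom f && Q [ffun x => f (inl x)] [ffun x => f (inr x)]]|
  = (\sum_(f : {ffun F -> G}) \sum_(f' : {ffun F' -> G})
      [&& is_hom f, is_hom f' & Q f f'])%N.
Proof.
rewrite pair_big /= -sum1_card big_mkcond /=.
pose join (p : {ffun F -> G} * {ffun F' -> G}) : {ffun graph_sum F F' -> G} :=
  [ffun x => match x with inl a => p.1 a | inr b => p.2 b end].
rewrite (reindex join) /=; last first.
  exists (fun f => ([ffun x => f (inl x)], [ffun x => f (inr x)])).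
    by move=> [f f'] _; congr (_, _); apply/ffunP => x; rewrite !ffunE.
  by move=> f _; apply/ffunP => -[] x; rewrite !ffunE.
apply: eq_bigr => -[f f'] _ /=; rewrite inE.
have -> : [ffun x => join (f, f') (inl x)] = f by apply/ffunP => x; rewrite !ffunE.
have -> : [ffun x => join (f, f') (inr x)] = f' by apply/ffunP => x; rewrite !ffunE.
have -> : is_hom (join (f, f')) = is_hom f && is_hom f'.
  apply/is_homP/andP => [hj|[/is_homP hf /is_homP hf'] [] x [] y //=].
    split; apply/is_homP => x y xy.
      by have := hj (inl x) (inl y) xy; rewrite !ffunE.
    by have := hj (inr x) (inr y) xy; rewrite !ffunE.
  - by rewrite !ffunE; apply: hf.
  - by rewrite !ffunE; apply: hf'.
by rewrite -andbA; case: ifP.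
Qed.

(** * Entries of homomorphism tensors *)

Section HomCount.
Variable t : nat.
Implicit Types (F : bigraph t) (G : graph).

Definition labels F : {ffun 'I_(t + t) -> F} := wcat (inlab F) (outlab F).

(** The entry of the homomorphism tensor at the word [w], kept as a natural number because it is
    cast both into real and into complex matrices. *)
Definition homcount F G (w : {ffun 'I_(t + t) -> G}) : nat :=
  #|[pred h : {ffun F -> G} | is_hom h && (pullback (labels F) h == w)]|.

Lemma pullback_labels F G (h : {ffun F -> G}) :
  pullback (labels F) h = wcat (pullback (inlab F) h) (pullback (outlab F) h).
Proof.
apply/ffunP => i; rewrite -(splitK i); case: fintype.split => j;
by rewrite /= ?wcatl ?wcatr !ffunE -?[lshift _ _]/(unsplit (inl j))
  -?[rshift _ _]/(unsplit (inr j)) unsplitK.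
Qed.

Lemma homtensorE (C : pzRingType) F G :
  homtensor C F G = mxof (fun x y => (homcount F (wcat x y))%:R).
Proof.
apply/matrixP => i j; rewrite !mxE; congr (_%:R); apply: eq_card => h.
rewrite !inE pullback_labels wcat_eq; congr (_ && (_ && _));
by apply/forallP/eqP => [e|<- k]; rewrite ?ffunE //; apply/ffunP => k;
   rewrite ffunE; apply/eqP.
Qed.

Lemma homcountE F G (w : {ffun 'I_(t + t) -> G}) :
  homcount F w = (\sum_h (is_hom h && (pullback (labels F) h == w)))%N.
Proof. by rewrite /homcount -sum1_card big_mkcond; apply: eq_bigr => h _. Qed.

Lemma sum_homcount F G :
  (\sum_(w : {ffun 'I_(t + t) -> G}) homcount F w)%N = Defs.hom F G.
Proof.
under eq_bigr do rewrite homcountE.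
rewrite exchange_big /= /Defs.hom -sum1_card [RHS]big_mkcond /=.
apply: eq_bigr => h _; rewrite inE; case: (is_hom h) => /=; last by rewrite big1.
by rewrite (bigD1 (pullback (labels F) h)) //= eqxx big1 // => w;
   rewrite eq_sym => /negPf->.
Qed.

(** The matrix product: [z] is the common image of the labels that are glued. *)
Lemma homcount_series F F' G (x y : {ffun 'I_t -> G}) :
  homcount (series F F') (wcat x y)
  = (\sum_z homcount F (wcat x z) * homcount F' (wcat z y))%N.
Proof.
pose Q (f : {ffun graph_sum F F' -> G}) :=
  (pullback (inlab F) [ffun a => f (inl a)] == x)
  && (pullback (outlab F') [ffun a => f (inr a)] == y).
transitivity #|[pred h : {ffun glue (@series_rel t F F') -> G} |
    is_hom h && Q (pullback (glue_proj (@series_rel t F F')) h)]|.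
  apply: eq_card => h; rewrite !inE pullback_labels wcat_eq /Q.
  by congr (_ && (_ && _)); congr (_ == _); apply/ffunP => i; rewrite !ffunE.
rewrite hom_glue.
pose Q' (f : {ffun F -> G}) (f' : {ffun F' -> G}) :=
  [&& pullback (outlab F) f == pullback (inlab F') f',
      pullback (inlab F) f == x & pullback (outlab F') f' == y].
transitivity #|[pred f : {ffun graph_sum F F' -> G} |
      is_hom f && Q' [ffun x => f (inl x)] [ffun x => f (inr x)]]|.
  apply: eq_card => f; rewrite !inE; congr (_ && (_ && _)).
  apply/forallP/eqP => [h|/ffunP e a].
    apply/ffunP => i; rewrite !ffunE; apply/eqP.
    apply: (implyP (forallP (h (inl (outlab F i))) (inr (inlab F' i)))).
    by apply/existsP; exists i; rewrite !eqxx.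
  apply/forallP => b; apply/implyP => /existsP[i /andP[/eqP-> /eqP->]].
  by have := e i; rewrite !ffunE => ->.
rewrite hom_graph_sum.
under [RHS]eq_bigr => z _ do rewrite !homcountE big_distrlr /=.
rewrite [RHS]exchange_big; apply: eq_bigr => f _.
rewrite [RHS]exchange_big; apply: eq_bigr => f' _ /=.
rewrite (bigD1 (pullback (outlab F) f)) //= big1 => [|z /negPf nz]; last first.
  by rewrite !pullback_labels !wcat_eq [_ == z]eq_sym nz !andbF.
rewrite !pullback_labels !wcat_eq eqxx addn0 mulnb /Q'; congr nat_of_bool.
by rewrite [pullback (inlab F') _ == _]eq_sym; do !case: (_ == _); do !case: is_hom.
Qed.

Lemma homcount_parallel F F' G (w : {ffun 'I_(t + t) -> G}) :
  homcount (parallel F F') w = (homcount F w * homcount F' w)%N.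
Proof.
pose Q (f : {ffun graph_sum F F' -> G}) :=
  pullback (labels F) [ffun a => f (inl a)] == w.
transitivity #|[pred h : {ffun glue (@parallel_rel t F F') -> G} |
    is_hom h && Q (pullback (glue_proj (@parallel_rel t F F')) h)]|.
  apply: eq_card => h; rewrite !inE; congr (_ && _); congr (_ == _).
  by rewrite !pullback_labels; congr wcat; apply/ffunP => i; rewrite !ffunE.
rewrite hom_glue.
pose Q' (f : {ffun F -> G}) (f' : {ffun F' -> G}) :=
  (pullback (labels F) f == w) && (pullback (labels F') f' == w).
transitivity #|[pred f : {ffun graph_sum F F' -> G} |
      is_hom f && Q' [ffun x => f (inl x)] [ffun x => f (inr x)]]|.
  apply: eq_card => f; rewrite !inE /Q /Q'; congr (_ && _).
  rewrite andbC; case: eqP => //= <-.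
  apply/forallP/eqP => [h|e a].
    rewrite !pullback_labels; congr wcat; apply/ffunP => i; rewrite !ffunE;
      apply/esym/eqP; [set x := inlab F i; set y := inlab F' i
                      |set x := outlab F i; set y := outlab F' i];
      by apply: (implyP (forallP (h (inl x)) (inr y)));
         apply/existsP; exists i; rewrite !eqxx ?orbT.
  move: e; rewrite !pullback_labels => /eqP.
  rewrite wcat_eq => /andP[/eqP/ffunP e /eqP/ffunP e'].
  apply/forallP => b; apply/implyP => /existsP[i /orP[]/andP[/eqP-> /eqP->]].
    by have := e i; rewrite !ffunE => ->.
  by have := e' i; rewrite !ffunE => ->.
rewrite hom_graph_sum !homcountE big_distrlr /=.
apply: eq_bigr => f _; apply: eq_bigr => f' _; rewrite mulnb /Q'.
by do !case: (_ == _); do !case: is_hom.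
Qed.

Lemma labels_perm F s : labels (bigraph_perm F s) = wperm s (labels F).
Proof. exact: wcat_split. Qed.

Lemma homcount_perm F G s (w : {ffun 'I_(t + t) -> G}) :
  homcount (bigraph_perm F s) w = homcount F (wperm s^-1%g w).
Proof.
apply: eq_card => h; rewrite !inE labels_perm; congr (_ && _).
have -> : pullback (wperm s (labels F)) h = wperm s (pullback (labels F) h).
  by apply/ffunP => i; rewrite !ffunE.
by rewrite -(can_eq (wpermKV s)) wpermK.
Qed.

Lemma homcount_iso F F' G (w : {ffun 'I_(t + t) -> G}) :
  bigraph_iso F F' -> homcount F' w = homcount F w.
Proof.
case=> f [bijf edgef inf outf].
have [g fK gK] := bijf.
have pull_inj : injective (@pullback F F' G f).
  move=> h h' /ffunP e; apply/ffunP => x.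
  by have := e (g x); rewrite !ffunE gK.
rewrite /homcount -(card_image pull_inj); apply: eq_card => h.
have labf i : f (labels F i) = labels F' i.
  by rewrite !ffunE; case: fintype.split.
apply/imageP/idP => [[h' + ->]|].
  rewrite !inE => /andP[/is_homP hom' /eqP <-]; apply/andP; split.
    by apply/is_homP => x y xy; rewrite !ffunE; apply: hom'; rewrite edgef.
  by apply/eqP/ffunP => i; rewrite !pullbackE labf.
rewrite inE => /andP[/is_homP homh /eqP <-].
have hE : h = pullback f (pullback g h).
  by apply/ffunP => x; rewrite !ffunE fK.
exists (pullback g h) => //; rewrite inE; apply/andP; split.
  apply/is_homP => x y xy; rewrite !ffunE; apply: homh.
  by rewrite -edgef !gK.
by apply/eqP/ffunP => i; rewrite !pullbackE -labf fK.
Qed.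

Lemma atomicP F : atomic F <-> forall x : F, exists i, labels F i = x.
Proof.
split=> [h x|h x].
  by case: (h x) => -[i <-]; [exists (lshift t i)|exists (rshift t i)];
     rewrite ?wcatl ?wcatr.
have [i <-] := h x; rewrite -(splitK i); case: fintype.split => j.
  by left; exists j; rewrite wcatl.
by right; exists j; rewrite wcatr.
Qed.

(* A map out of an atomic graph is determined by the images of the labels. *)
Lemma homcount_atomic F G (w : {ffun 'I_(t + t) -> G}) : atomic F ->
  homcount F w = [forall i, forall j,
    ((labels F i == labels F j) ==> (w i == w j))
    && (edge (labels F i) (labels F j) ==> edge (w i) (w j))].
Proof.
move=> /atomicP/choice[ix ixK].
pose h0 : {ffun F -> G} := [ffun x => w (ix x)].
have homE (h : {ffun F -> G}) :
    (is_hom h && (pullback (labels F) h == w))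
    = (is_hom h0 && (pullback (labels F) h0 == w)) && (h == h0).
  have [->|neq] := eqVneq h h0; first by rewrite andbT.
  rewrite andbF; apply/negP => /andP[_ /eqP e]; case/eqP: neq.
  by apply/ffunP => x; rewrite ffunE -e pullbackE ixK.
rewrite homcountE; under eq_bigr do rewrite homE.
rewrite (bigD1 h0) //= eqxx andbT big1 ?addn0 => [|h /negPf->]; last first.
  by rewrite andbF.
congr nat_of_bool; apply/andP/forallP => [[/is_homP hh /eqP/ffunP hw] i|hw].
  apply/forallP => j; apply/andP; split; apply/implyP.
    by move=> /eqP lij; rewrite -!hw !pullbackE lij.
  by move=> /hh; have := hw i; have := hw j; rewrite !pullbackE => -> ->.
have hl i : h0 (labels F i) = w i.
  have /andP[/implyP/(_ (introT eqP (ixK _)))/eqP + _] :=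
    forallP (hw (ix (labels F i))) i.
  by rewrite [h0 _]ffunE.
split; last by apply/eqP/ffunP => i; rewrite pullbackE hl.
apply/is_homP => x y; rewrite -(ixK x) -(ixK y) !hl => xy.
by have /andP[_ /implyP/(_ xy)] := forallP (hw (ix x)) (ix y).
Qed.

Lemma homcount_atomic_atp F (G H : graph)
    (g : {ffun 'I_(t + t) -> G}) (h : {ffun 'I_(t + t) -> H}) :
  atomic F -> same_atp g h -> homcount F g = homcount F h.
Proof.
move=> atF /forallP gh; rewrite !homcount_atomic //; congr nat_of_bool.
apply: eq_forallb => i; apply: eq_forallb => j.
by have /andP[/eqP-> /eqP->] := forallP (gh i) j.
Qed.

Lemma symor_sym (T : finType) (e : rel T) : symmetric (fun x y => e x y || e y x).
Proof. by move=> x y; rewrite orbC. Qed.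

Definition rel_graph (T : finType) (e : rel T) : graph := Graph (symor_sym e).

(** The [2t] label positions themselves serve as vertices, with edges [e] (symmetrised) and glued
    along [r], so that every vertex is labelled by construction. *)
Definition atomic_of (r e : rel 'I_(t + t)) : bigraph t :=
  @BiGraph t (@glue (rel_graph e) r)
    [ffun i => @glue_proj (rel_graph e) r (lshift t i)]
    [ffun i => @glue_proj (rel_graph e) r (rshift t i)].

Lemma labels_atomic_of r e i : labels (atomic_of r e) i = @glue_proj (rel_graph e) r i.
Proof.
by rewrite -{2}(splitK i) ffunE; case: fintype.split => j; rewrite ffunE.
Qed.

Lemma atomic_atomic_of r e : atomic (atomic_of r e).
Proof.
by apply/atomicP => x; exists (repr x); rewrite labels_atomic_of /glue_proj reprK.
Qed.

Lemma homcount_atomic_of r e G (w : {ffun 'I_(t + t) -> G}) :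
  homcount (atomic_of r e) w
  = [forall i, forall j, (r i j ==> (w i == w j)) && (e i j ==> edge (w i) (w j))].
Proof.
transitivity #|[pred h : {ffun @glue (rel_graph e) r -> G} |
    is_hom h && (pullback (@glue_proj (rel_graph e) r) h == w)]|.
  apply: eq_card => h; rewrite !inE; congr (_ && _); congr (_ == _).
  by apply/ffunP => i; rewrite !pullbackE labels_atomic_of.
rewrite (@hom_glue (rel_graph e) G r (fun f => f == w)) -sum1_card big_mkcond /=.
rewrite (bigD1 w) //= big1 => [|f /negPf nf]; last by rewrite inE nf !andbF.
rewrite inE eqxx andbT addn0 /=.
set b := (X in if X then _ else _); set c := [forall i, _].
suff -> : b = c by case: c.
apply/andP/forallP => [[/is_homP hw /forallP rw] i|h].
  apply/forallP => j; rewrite (forallP (rw i) j); apply/implyP => eij.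
  by apply: hw; rewrite /= eij.
have re i j := andP (forallP (h i) j); split.
  apply/is_homP => i j /= /orP[] eij; first exact: (implyP (re i j).2).
  by rewrite edge_sym; exact: (implyP (re j i).2).
by apply/forallP => i; apply/forallP => j; have [] := re i j.
Qed.

End HomCount.

(** * The Lasserre relaxation *)

Lemma mxat_mxof (C : Type) (T : finType) (f : T -> T -> C) x y :
  mxat (mxof f) x y = f x y.
Proof. by rewrite /mxat mxE !enum_rankK. Qed.

(** Membership in [PSD] makes the matrix real, and the conditions on its entries transfer along the
    injective ring morphism [real_complex]. *)
Lemma level_isomorphic_PSD (R : realType) t (G H : graph) :
  level_isomorphic (PSD R) t G H <->
  exists M : 'M[R]_#|{ffun 'I_t -> (G * H)%type}|, psdmx M /\ iso_matrix M.
Proof.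
have rcinj := fmorph_inj (real_complex R).
have entryE (M : 'M[R]_#|{ffun 'I_t -> (G * H)%type}|) g h :
    entry (map_mx (real_complex R) M) g h = real_complex R (entry M g h).
  by rewrite /entry /mxat mxE.
split=> [[_ [[M psdM ->] [sum suml sumr atp perm]]]|[M [psdM]]].
  exists M; split=> //; split=> [g h i|h|g|g h gh|g h s]; apply: rcinj;
    rewrite ?rmorph0 ?rmorph1 ?rmorph_sum.
  - transitivity (\sum_a entry (map_mx (real_complex R) M) (upd g i a) h).
      by apply: eq_bigr => a _; rewrite entryE.
    by rewrite sum; apply: eq_bigr => a _; rewrite entryE.
  - by rewrite -(suml h); apply: eq_bigr => a _; rewrite entryE.
  - by rewrite -(sumr g); apply: eq_bigr => a _; rewrite entryE.
  - by have := atp _ _ gh; rewrite entryE.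
  - by have := perm g h s; rewrite !entryE.
move=> [sum suml sumr atp perm]; exists (map_mx (real_complex R) M).
split; first by exists M.
split=> [g h i|h|g|g h gh|g h s].
- transitivity (real_complex R (\sum_a entry M (upd g i a) h)).
    by rewrite rmorph_sum; apply: eq_bigr => a _; rewrite entryE.
  by rewrite sum rmorph_sum; apply: eq_bigr => a _; rewrite entryE.
- by under eq_bigr do rewrite entryE; rewrite -rmorph_sum suml rmorph1.
- by under eq_bigr do rewrite entryE; rewrite -rmorph_sum sumr rmorph1.
- by rewrite entryE atp ?rmorph0.
- by rewrite !entryE -perm.
Qed.

(** * Words and their sets of letters *)

Section WordSets.
Variable P : finType.

Definition wset n (w : {ffun 'I_n -> P}) : {set P} := [set w i | i : 'I_n].

Lemma card_wset n (w : {ffun 'I_n -> P}) : (#|wset w| <= n)%N.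
Proof. by rewrite -[leqRHS]card_ord; exact: leq_imset_card. Qed.

Lemma wset_wcat t (u v : {ffun 'I_t -> P}) : wset (wcat u v) = wset u :|: wset v.
Proof.
apply/setP => p; rewrite inE; apply/imsetP/orP => [[i _ ->]|].
  by rewrite -(splitK i); case: fintype.split => j; [left|right];
    rewrite /= ?wcatl ?wcatr; exact: imset_f.
by case=> /imsetP[i _ ->]; [exists (lshift t i)|exists (rshift t i)];
  rewrite ?wcatl ?wcatr.
Qed.

Lemma wset_neq0 n (w : {ffun 'I_n -> P}) : (0 < n)%N -> wset w != set0.
Proof. by case: n w => // n w _; apply/set0Pn; exists (w ord0); exact: imset_f. Qed.

Lemma wset_const n (p : P) : (0 < n)%N -> wset [ffun _ : 'I_n => p] = [set p].
Proof.
case: n => // n _; apply/setP => q; rewrite inE.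
apply/imsetP/eqP => [[i _ ->]|->]; first by rewrite ffunE.
by exists ord0; rewrite ?ffunE.
Qed.

Lemma wset_surj n (I : {set P}) : I != set0 -> (#|I| <= n)%N ->
  exists w : {ffun 'I_n -> P}, wset w = I.
Proof.
(* The enumeration of [I], padded with its element [p] up to length [n]. *)
move=> /set0Pn[p Ip] cI; exists [ffun i : 'I_n => nth p (enum I) i].
apply/setP => q; apply/imsetP/idP => [[i _ ->]|Iq].
  rewrite ffunE; have [lt|ge] := ltnP i (size (enum I)).
    by rewrite -mem_enum mem_nth.
  by rewrite nth_default.
have lt : (index q (enum I) < n)%N.
  by apply: leq_trans cI; rewrite cardE index_mem mem_enum.
by exists (Ordinal lt) => //; rewrite ffunE nth_index // mem_enum.
Qed.

Lemma wset_dup n (w : {ffun 'I_n -> P}) : (#|wset w| < n)%N ->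
  exists i k, i != k /\ w i = w k.
Proof.
move=> lt; have /injectivePn[i [k ik wik]] : ~~ injectiveb w.
  by apply/negP => /injectiveP inj; rewrite /wset card_imset // card_ord ltnn in lt.
by exists i, k.
Qed.

(** Position [i] is redundant, since [k] carries the same letter; overwriting it loses nothing. *)
Lemma wset_upd n (w : {ffun 'I_n -> P}) i k p : i != k -> w i = w k ->
  wset (upd w i p) = wset w :|: [set p].
Proof.
move=> ik wik; apply/setP => q; rewrite !inE; apply/imsetP/orP.
  move=> [j _ ->]; rewrite ffunE; case: eqP => _; [by right|left].
  exact: imset_f.
case=> [/imsetP[j _ ->]|/eqP->]; last by exists i; rewrite ?ffunE ?eqxx.
have [->|ji] := eqVneq j i.
  by exists k => //; rewrite ffunE eq_sym (negPf ik).
by exists j => //; rewrite ffunE (negPf ji).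
Qed.

(* Two words with the same letters are joined by transpositions and by
   overwriting repeated letters; each move below decreases the number of
   positions where the words disagree. *)
Lemma wset_invariant n (V : Type) (f : {ffun 'I_n -> P} -> V) :
  (forall (w : {ffun 'I_n -> P}) i j, f w = f [ffun k => w (tperm i j k)]) ->
  (forall (w : {ffun 'I_n -> P}) i k j, i != k -> w i = w k -> j != i ->
    f w = f (upd w i (w j))) ->
  forall w w' : {ffun 'I_n -> P}, wset w = wset w' -> f w = f w'.
Proof.
move=> ftperm fdup w w'.
have [c] := ubnP #|[pred i | w i != w' i]|.
elim: c w w' => // c IHc w w' lec ww'.
(* Overwriting a redundant wrong position by the letter wanted there keeps the set of letters and
   corrects one position. *)
have repl (v v' : {ffun 'I_n -> P}) i k : i != k -> v i = v k -> v i != v' i ->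
    wset v = wset v' ->
    exists j, [/\ j != i, v j = v' i, wset (upd v i (v j)) = wset v' &
      (#|[pred i0 | upd v i (v j) i0 != v' i0]| < #|[pred i0 | v i0 != v' i0]|)%N].
  move=> ik vik viv' vv'; have : v' i \in wset v by rewrite vv' imset_f.
  move=> /imsetP[j _ v'i]; have ji : j != i.
    by apply: contra_neq viv' => ji; rewrite v'i ji.
  exists j; split=> //.
    rewrite (wset_upd _ ik) // -vv'; apply/setP => q; rewrite !inE.
    by case: eqP => [->|_]; rewrite ?orbF // orbT; apply/esym/imset_f.
  apply/proper_card/properP; split.
    apply/subsetP => l; rewrite !inE ffunE.
    by have [->|//] := eqVneq l i; rewrite v'i eqxx.
  by exists i; rewrite !inE ?ffunE ?eqxx -?v'i ?eqxx.
have [/existsP[i /existsP[k /and3P[ik /eqP wik nwi]]]|nodup] :=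
    boolP [exists i, exists k, [&& i != k, w i == w k & w i != w' i]].
  have [j [ji wj wsetE lt]] := repl w w' i k ik wik nwi ww'.
  rewrite (fdup w i k j) //; apply: IHc wsetE.
  exact: leq_trans lt lec.
have [/existsP[i /existsP[k /and3P[ik /eqP wik nwi]]]|nodup'] :=
    boolP [exists i, exists k, [&& i != k, w' i == w' k & w' i != w i]].
  have [j [ji wj wsetE lt]] := repl w' w i k ik wik nwi (esym ww').
  rewrite (fdup w' i k j) //; apply/esym/IHc; last exact: wsetE.
  apply: leq_trans lt _; rewrite -ltnS; apply: leq_trans lec.
  by rewrite ltnS; apply/eq_leq/eq_card => l; rewrite !inE eq_sym.
have [/existsP[i nwi]|eqw] := boolP [exists i, w i != w' i]; last first.
  congr f; apply/ffunP => i; apply/eqP; move: eqw; rewrite negb_exists.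
  by move=> /forallP/(_ i); rewrite negbK.
have : w' i \in wset w by rewrite ww' imset_f.
move=> /imsetP[k _ w'i].
have ki : k != i by apply: contra_neq nwi => ki; rewrite w'i ki.
(* The letter wanted at [i] sits at [k]. Were [k] already correct, [w'] would repeat a letter at the
   wrong position [i]. Hence the transposition of [i] and [k] corrects [i] and spoils nothing. *)
have nwk : w k != w' k.
  apply: contraNneq nodup' => wk; apply/existsP; exists i; apply/existsP; exists k.
  by rewrite eq_sym ki w'i wk eqxx -wk -w'i eq_sym nwi.
rewrite (ftperm w i k); apply: IHc.
  rewrite -ltnS; apply: leq_trans lec; rewrite ltnS.
  apply/proper_card/properP; split.
    apply/subsetP => l; rewrite !inE ffunE.
    by case: tpermP => [->|->|_ _] //; rewrite -?w'i ?eqxx.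
  by exists i; rewrite !inE ?ffunE ?tpermL -?w'i ?eqxx // w'i eq_sym.
rewrite -ww'; apply/setP => q; apply/imsetP/imsetP => [[l _ ->]|[l _ ->]].
  by rewrite ffunE; exists (tperm i k l).
by exists (tperm i k l); rewrite ?ffunE ?tpermK.
Qed.

End WordSets.

(** A word is [upd g i a] for exactly [#|T|] pairs of [g] and [a], because the old letter at [i] is
    forgotten. *)
Lemma sum_upd (V : nmodType) n (T : finType) (i : 'I_n)
    (f : {ffun 'I_n -> T} -> V) :
  \sum_g \sum_a f (upd g i a) = (\sum_g f g) *+ #|T|.
Proof.
have updE g : upd g i (g i) = g :> {ffun 'I_n -> T}.
  by apply/ffunP => j; rewrite ffunE; case: eqP => [->|].
have updK g a b : upd (upd g i a) i b = upd g i b :> {ffun 'I_n -> T}.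
  by apply/ffunP => j; rewrite !ffunE; case: eqP.
have updi g a : (upd g i a : {ffun 'I_n -> T}) i = a by rewrite ffunE eqxx.
rewrite exchange_big /= -sumr_const.
under eq_bigr => a _ do
  rewrite (partition_big (fun g : {ffun 'I_n -> T} => g i) xpredT) //=.
rewrite exchange_big /=; apply: eq_big => // b _.
rewrite [RHS](partition_big (fun g : {ffun 'I_n -> T} => g i) xpredT) //=.
apply: eq_bigr => a _.
rewrite [RHS](reindex_onto (fun g => upd g i a) (fun g => upd g i b)) /=.
  apply: eq_big => [g|g _] //.
  by rewrite updi eqxx updK; apply/eqP/eqP => [<-|<-]; rewrite ?updE ?updi.
by move=> g /eqP <-; rewrite updK updE.
Qed.

(** The positions are summed out one at a time. The partial sums [S k] still run over all words of
    length [n], so each step produces a factor [#|T|]; these factors are cancelled at the end. *)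
Lemma sum_wset (R : realType) n (T P : finType) (c : 'I_n -> T -> P)
    (y : {set P} -> R) : (0 < #|T|)%N ->
  (forall (I : {set P}) i, (#|I| < n)%N ->
     \sum_a y (I :|: [set c i a]) = y I) ->
  \sum_(g : {ffun 'I_n -> T}) y (wset [ffun i => c i (g i)]) = y set0.
Proof.
move=> T_gt0 ysum.
pose S k := \sum_(g : {ffun 'I_n -> T}) y [set c i (g i) | i : 'I_n & (i < k)%N].
have SE k : (k <= n)%N -> S k *+ #|T| ^ k = y set0 *+ #|T| ^ n.
  elim: k => [_|k IHk lt].
    rewrite mulr1n /S (eq_bigr (fun=> y set0)) ?sumr_const ?card_ffun ?card_ord //.
    move=> g _; congr y; apply/setP => p; rewrite inE.
    by apply/negbTE/negP => /imsetP[i +]; rewrite inE.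
  rewrite expnS mulrnA -(IHk (ltnW lt)); congr (_ *+ _).
  rewrite -(sum_upd (Ordinal lt)); apply: eq_bigr => g _.
  rewrite -(ysum _ (Ordinal lt)); last first.
    apply: leq_ltn_trans (leq_imset_card _ _) _.
    rewrite -[ltnRHS]card_ord -cardsT; apply/proper_card/properP; split=> //.
    by exists (Ordinal lt); rewrite ?inE //= ltnn.
  apply: eq_bigr => a _; congr y; apply/setP => p; rewrite !inE.
  apply/imsetP/orP => [[i +]|[/imsetP[i +]|/eqP->]].
  - rewrite inE ltnS leq_eqVlt => /orP[/eqP ik|ik] ->.
      have -> : i = Ordinal lt by apply: val_inj.
      by right; rewrite ffunE eqxx.
    left; apply/imsetP; exists i; rewrite ?inE //. rewrite ffunE.
    by case: eqP ik => // ->; rewrite ltnn.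
  - rewrite inE => ik ->; exists i; first by rewrite inE ltnW.
    rewrite ffunE.
    by case: eqP ik => // ->; rewrite ltnn.
  - by exists (Ordinal lt); rewrite ?inE ?ltnSn // ffunE eqxx.
have /eqP := SE n (leqnn n).
rewrite -subr_eq0 -mulrnBl mulrn_eq0 expn_eq0 gtn_eqF //= subr_eq0 => /eqP <-.
apply: eq_bigr => g _; congr y; apply/setP => p.
by apply/imsetP/imsetP => -[i _ ->]; exists i; rewrite ?inE ?ffunE.
Qed.

(** * Summation constraints for sets of size up to [2t - 1] *)

Section LasserreSums.
Variables (R : realType) (t : nat) (P T : finType) (c : T -> P).
Variable y : {set P} -> R.
Hypothesis t_gt0 : (0 < t)%N.
Hypothesis psdy :
  psdmx (\matrix_(i, j < #|[set I : {set P} | #|I| <= t]%N|)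
           y (enum_val i :|: enum_val j)).

(* The combination of rows [J + c a] minus the row [J], [#|J| < t], lies in the
   kernel of the moment matrix; splitting a set of size at most [2t - 1] as
   [J + K] with [#|K| <= t] yields the constraint one level further up than
   postulated. *)
Lemma moment_sum :
  (forall I : {set P}, (#|I| <= 2 * t - 2)%N -> \sum_a y (I :|: [set c a]) = y I) ->
  (forall (I : {set P}) a b, (#|I| <= 2 * t)%N -> a != b ->
     c a \in I -> c b \in I -> y I = 0) ->
  forall I : {set P}, (#|I| < 2 * t)%N -> \sum_a y (I :|: [set c a]) = y I.
Proof.
move=> ysum y0 I cI.
pose K := [set p in take t (enum I)]; pose J := [set p in drop t (enum I)].
have IE : I = J :|: K.
  apply/setP => p; rewrite !inE orbC -mem_cat cat_take_drop mem_enum //.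
have cK : (#|K| <= t)%N.
  rewrite cardsE; apply: leq_trans (card_size _) _.
  by rewrite size_take; case: ltnP.
have cJ : (#|J| < t)%N.
  rewrite cardsE; apply: leq_ltn_trans (card_size _) _.
  by rewrite size_drop -cardE; lia.
pose L := \matrix_(i, j < #|[set I : {set P} | #|I| <= t]%N|)
  y (enum_val i :|: enum_val j).
have set0t : set0 \in [set I : {set P} | #|I| <= t]%N by rewrite inE cards0.
pose rk (A : {set P}) := enum_rank_in set0t A.
have rkK (A : {set P}) : (#|A| <= t)%N -> enum_val (rk A) = A.
  by move=> cA; rewrite enum_rankK_in // inE.
have LE (A B : {set P}) : (#|A| <= t)%N -> (#|B| <= t)%N ->
    L (rk A) (rk B) = y (A :|: B) by move=> cA cB; rewrite mxE !rkK.
have cJa a : (#|J :|: [set c a]| <= t)%N.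
  by apply: leq_trans (leq_card_setU _ _) _; rewrite cards1 addn1.
pose e A : 'rV[R]__ := delta_mx 0 (rk A).
have eLe A B : (e A *m L *m (e B)^T) 0 0 = L (rk A) (rk B) by exact: delta_form.
pose x := \sum_a e (J :|: [set c a]) - e J.
have xL (A : {set P}) : (#|A| <= t)%N ->
    (x *m L *m (e A)^T) 0 0 = \sum_a y (J :|: A :|: [set c a]) - y (J :|: A).
  move=> cA; rewrite /x !mulmxBl submxE eLe LE ?(ltnW cJ) //.
  rewrite !mulmx_suml summxE; congr (_ - _); apply: eq_bigr => a _.
  by rewrite eLe LE // setUAC.
(* The term [b = a] cancels against the subtracted one. For [b != a] the set contains both [c a] and
   [c b], where [y] vanishes. *)
have xLJ a : (x *m L *m (e (J :|: [set c a]))^T) 0 0 = 0.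
  rewrite xL // (bigD1 a) //= big1 => [|b ba].
    by rewrite addr0 setUA setUid -setUA setUid subrr.
  apply: (y0 _ a b); rewrite 1?eq_sym ?inE ?eqxx ?orbT //.
  apply: leq_trans (leq_card_setU _ _) _; rewrite cards1 setUA setUid.
  by have := cJa a; lia.
have xLx : (x *m L *m x^T) 0 0 = 0.
  rewrite {2}/x linearB /= linear_sum /= mulmxBr submxE mulmx_sumr summxE.
  rewrite big1 ?sub0r => [|a _]; last exact: xLJ.
  (* The set here is [J] itself, of size at most [t - 1 <= 2 * t - 2], so the postulated constraint
     applies. *)
  rewrite xL ?(ltnW cJ) // setUid ysum ?subrr ?oppr0 //; lia.
have := xL K cK; rewrite (psdmx_null psdy xLx) mul0mx mxE -IE.
by move/esym/eqP; rewrite subr_eq0 => /eqP.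
Qed.

End LasserreSums.

(** * The Lasserre relaxation and level-t PSD-isomorphism *)

Section LasserreIso.
Variables (R : realType) (t : nat) (G H : graph).
Hypothesis t_gt0 : (0 < t)%N.

Lemma partial_iso_inj (I : {set G * H}) g h g' h' :
  partial_iso I -> (g, h) \in I -> (g', h') \in I -> (g == g') = (h == h').
Proof.
case=> l [f [f' [/forallP atp ->]]] /imsetP[i _ [-> ->]] /imsetP[j _ [-> ->]].
by have /andP[/eqP] := forallP (atp i) j.
Qed.

(** The type passes from the enumeration that witnesses [partial_iso] to every other word with the
    same letters. *)
Lemma partial_iso_same_atp n (g : {ffun 'I_n -> G}) (h : {ffun 'I_n -> H}) :
  partial_iso (wset [ffun i => (g i, h i)]) -> same_atp g h.
Proof.
case=> l [f [f' [/forallP atp e]]].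
have ix i : exists j, f j = g i /\ f' j = h i.
  have : (g i, h i) \in wset [ffun i => (g i, h i)].
    by apply/imsetP; exists i; rewrite ?ffunE.
  by rewrite e => /imsetP[j _ [-> ->]]; exists j.
apply/forallP => i; apply/forallP => j.
have [a [<- <-]] := ix i; have [b [<- <-]] := ix j.
exact: (forallP (atp a) b).
Qed.

Lemma same_atp_partial_iso n (g : {ffun 'I_n -> G}) (h : {ffun 'I_n -> H}) :
  same_atp g h -> partial_iso (wset [ffun i => (g i, h i)]).
Proof.
move=> atp; exists n, g, h; split=> //.
by apply/setP => p; apply/imsetP/imsetP => -[i _ ->]; exists i; rewrite ?ffunE.
Qed.

Lemma lasserre_level_isomorphic :
  lasserre_feasible R t G H -> (0 < #|G|)%N -> (0 < #|H|)%N ->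
  level_isomorphic (PSD R) t G H.
Proof.
case=> y [psdy sumr suml piso y0] G_gt0 H_gt0; apply/level_isomorphic_PSD.
(* Two pairs sharing one coordinate only cannot lie in a partial isomorphism; this is the vanishing
   hypothesis of [moment_sum]. *)
have ysumr (I : {set G * H}) g : (#|I| < 2 * t)%N ->
    \sum_h y (I :|: [set (g, h)]) = y I.
  apply: (moment_sum t_gt0 psdy); first by move=> J; exact: sumr.
  move=> J a b cJ ab Ja Jb; apply: piso => // pJ.
  by have := partial_iso_inj pJ Ja Jb; rewrite eqxx (negPf ab).
have ysuml (I : {set G * H}) h : (#|I| < 2 * t)%N ->
    \sum_g y (I :|: [set (g, h)]) = y I.
  apply: (moment_sum (c := fun g => (g, h)) t_gt0 psdy).
    by move=> J; exact: suml.
  move=> J a b cJ ab Ja Jb; apply: piso => // pJ.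
  by have := partial_iso_inj pJ Ja Jb; rewrite eqxx (negPf ab).
pose M : 'M[R]_#|{ffun 'I_t -> (G * H)%type}| := mxof (fun u v => y (wset (wcat u v))).
exists M.
have entryE g h : entry M g h = y (wset [ffun i => (g i, h i)]).
  by rewrite /entry /M mxat_mxof wcat_split.
split.
  have set0t : set0 \in [set I : {set G * H} | #|I| <= t]%N by rewrite inE cards0.
  pose f (i : 'I_#|{ffun 'I_t -> (G * H)%type}|) :=
    enum_rank_in set0t (wset (enum_val i)).
  have := psdmx_mxsub f psdy; congr psdmx; apply/matrixP => i j.
  by rewrite !mxE !enum_rankK_in ?inE ?card_wset // wset_wcat.
have wsetU g h (i : 'I_(t + t)) a b :
    wset [ffun j => (upd g i a j, upd h i b j)]
    = [set (g j, h j) | j : 'I_(t + t) & j != i] :|: [set (a, b)] :> {set G * H}.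
  apply/setP => p; rewrite !inE; apply/imsetP/orP => [[j _ ->]|].
    rewrite !ffunE; have [_|ji] := eqVneq j i; first by right.
    by left; apply/imsetP; exists j; rewrite ?inE.
  case=> [/imsetP[j + ->]|/eqP->].
    by rewrite inE => /negPf ji; exists j => //; rewrite !ffunE ji.
  by exists i; rewrite // !ffunE eqxx.
have cU g h (i : 'I_(t + t)) :
    (#|([set (g j, h j) | j : 'I_(t + t) & j != i] : {set G * H})| < 2 * t)%N.
  apply: leq_ltn_trans (leq_imset_card _ _) _.
  rewrite -cardsE /= (_ : [set _ | _] = [set~ i]); last first.
    by apply/setP => j; rewrite !inE.
  by rewrite cardsC1 card_ord; lia.
have updE (T : finType) (g : {ffun 'I_(t + t) -> T}) i : upd g i (g i) = g.
  by apply/ffunP => j; rewrite ffunE; case: eqP => [->|].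
split=> [g h i|h|g|g h gh|g h s].
(* Both sums equal [y] at the set of pairs in the other positions, which has fewer than [2 * t]
   elements. *)
- transitivity (y [set (g j, h j) | j : 'I_(t + t) & j != i]).
    rewrite -(ysuml _ (h i)) //; apply: eq_bigr => a _.
    by rewrite entryE -wsetU updE.
  rewrite -(ysumr _ (g i)) //; apply: eq_bigr => b _.
  by rewrite entryE -wsetU updE.
- rewrite -y0 -(sum_wset (c := fun i (a : G) => (a, h i)) (n := (t + t)%N)) //.
    by apply: eq_bigr => g _; rewrite entryE.
  by move=> I i cI; apply: ysuml; rewrite mul2n -addnn.
- rewrite -y0 -(sum_wset (c := fun i (b : H) => (g i, b)) (n := (t + t)%N)) //.
    by apply: eq_bigr => h _; rewrite entryE.
  by move=> I i cI; apply: ysumr; rewrite mul2n -addnn.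
- rewrite entryE piso //; first by rewrite mul2n -addnn card_wset.
  by move/partial_iso_same_atp => atp; rewrite atp in gh.
- rewrite !entryE; congr y; apply/setP => p; apply/imsetP/imsetP => -[i _ ->].
    by exists (s^-1%g i); rewrite // !ffunE permKV.
  by exists (s i); rewrite // !ffunE.
Qed.

Lemma level_isomorphic_lasserre :
  (0 < #|G|)%N -> (0 < #|H|)%N ->
  level_isomorphic (PSD R) t G H -> lasserre_feasible R t G H.
Proof.
move=> /card_gt0P[g0 _] /card_gt0P[h0 _].
move=> /level_isomorphic_PSD[M [psdM [Msum suml sumr atp perm]]].
pose P := (G * H)%type.
pose f (w : {ffun 'I_(t + t) -> P}) := mxat M (wleft w) (wright w).
have fE w : f w = entry M [ffun i => (w i).1] [ffun i => (w i).2].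
  by rewrite /entry /f; congr (mxat M (wleft _) (wright _)); apply/ffunP => i;
     rewrite !ffunE -surjective_pairing.
have t2_gt0 : (0 < t + t)%N by rewrite addn_gt0 t_gt0.
have f0 (w : {ffun 'I_(t + t) -> P}) i j :
    ((w i).1 == (w j).1) != ((w i).2 == (w j).2) -> f w = 0.
  move=> wij; rewrite fE atp //; apply: contra wij => /forallP/(_ i)/forallP/(_ j).
  by rewrite !ffunE => /andP[/eqP-> _]; rewrite eqxx.
have updE (w : {ffun 'I_(t + t) -> P}) i : upd w i (w i) = w.
  by apply/ffunP => j; rewrite ffunE; case: eqP => [->|].
have updK (w : {ffun 'I_(t + t) -> P}) i p q : upd (upd w i p) i q = upd w i q.
  by apply/ffunP => j; rewrite !ffunE; case: eqP.
have fsum (w : {ffun 'I_(t + t) -> P}) i g h :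
    \sum_a f (upd w i (a, h)) = \sum_b f (upd w i (g, b)).
  have := Msum [ffun j => (upd w i (g, h) j).1] [ffun j => (upd w i (g, h) j).2] i.
  congr (_ = _); apply: eq_bigr => a _; rewrite fE; congr entry;
    by apply/ffunP => j; rewrite !ffunE; case: eqP.
(* A letter [p] at another position [k] leaves a single term, as any other partner of [p.1] clashes
   with [p]. *)
have sumb (w : {ffun 'I_(t + t) -> P}) i k p : i != k -> w k = p ->
    \sum_b f (upd w i (p.1, b)) = f (upd w i p).
  move=> ik wk; rewrite (bigD1 p.2) //= big1 ?addr0 -?surjective_pairing //.
  move=> b bp; apply: (f0 _ i k).
  by rewrite !ffunE eqxx eq_sym in ik *; rewrite (negPf ik) wk /= eqxx (negPf bp).
have suma (w : {ffun 'I_(t + t) -> P}) i k p : i != k -> w k = p ->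
    \sum_a f (upd w i (a, p.2)) = f (upd w i p).
  move=> ik wk; rewrite (bigD1 p.1) //= big1 ?addr0 -?surjective_pairing //.
  move=> a ap; apply: (f0 _ i k).
  by rewrite !ffunE eqxx eq_sym in ik *; rewrite (negPf ik) wk /= eqxx (negPf ap).
have fsumb (w : {ffun 'I_(t + t) -> P}) i k g : i != k -> w i = w k ->
    \sum_b f (upd w i (g, b)) = f w.
  by move=> ik wik; rewrite -(fsum w i g (w k).2) (suma w i k) // -wik updE.
(* Transpositions are covered by the symmetry of [M]. Before and after overwriting the redundant
   position [i] by the letter at [j], the value equals the sum over the second coordinate at [i]. *)
have fset : forall w w', wset w = wset w' -> f w = f w'.
  apply: wset_invariant => [w i j|w i k j ik wik ji].
    rewrite [in LHS]fE (perm _ _ (tperm i j)) fE.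
    by congr entry; apply/ffunP => k; rewrite !ffunE.
  by rewrite -(fsumb w i k (w j).1) // (sumb w i j) // eq_sym.
(* No word of positive length has an empty set of letters, so the value at [set0] is prescribed;
   sets with more than [2t] elements get the default 0. *)
pose y I := if I == set0 then 1 else
  if [pick w : {ffun 'I_(t + t) -> P} | wset w == I] is Some w then f w else 0.
have yE w : y (wset w) = f w.
  rewrite /y (negPf (wset_neq0 _ _)) //.
  by case: pickP => [w' /eqP/fset //|/(_ w)]; rewrite eqxx.
(* Against the constant word [g], only constant words [h] have the same atomic type and contribute
   to the row sum. *)
have y_set1 g : \sum_h y [set (g, h)] = 1.
  rewrite -(sumr [ffun=> g]).
  pose cst (h : H) : {ffun 'I_(t + t) -> H} := [ffun=> h].
  have cstI : injective cst.
    by move=> h h' /ffunP/(_ (Ordinal t2_gt0)); rewrite !ffunE.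
  rewrite (bigID (mem [set cst h | h : H])) /= [X in _ + X]big1 ?addr0.
    rewrite big_imset /=; last by move=> h h' _ _ /cstI.
    apply: eq_bigr => h _; rewrite -(wset_const (g, h) t2_gt0) yE fE.
    by congr entry; apply/ffunP => j; rewrite !ffunE.
  move=> h /negP hn; apply: atp; apply/negP => /forallP/(_ (Ordinal t2_gt0)) gh.
  case: hn; apply/imsetP; exists (h (Ordinal t2_gt0)) => //; apply/ffunP => j.
  have /andP[+ _] := forallP gh j.
  by rewrite !ffunE eqxx => /eqP/esym/eqP/esym.
have ysumr (I : {set P}) g : (#|I| < t + t)%N -> \sum_h y (I :|: [set (g, h)]) = y I.
  move=> cI; have [->|I0] := eqVneq I set0.
    by under eq_bigr do rewrite set0U; rewrite y_set1 /y eqxx.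
  have [w wI] := wset_surj I0 (ltnW cI); rewrite -{}wI in cI *.
  have [i [k [ik wik]]] := wset_dup cI.
  rewrite yE -(fsumb w i k g) //; apply: eq_bigr => h _.
  by rewrite -yE (wset_upd _ ik).
have ysuml (I : {set P}) h : I != set0 -> (#|I| < t + t)%N ->
    \sum_g y (I :|: [set (g, h)]) = y I.
  move=> I0 cI; have [w wI] := wset_surj I0 (ltnW cI); rewrite -{}wI in cI *.
  have [i [k [ik wik]]] := wset_dup cI.
  rewrite yE -(fsumb w i k g0) // -(fsum w i g0 h); apply: eq_bigr => g _.
  by rewrite -yE (wset_upd _ ik).
(* At the empty set, the sum over [g] is compared with the known sum over [b] through the double sum
   of [y] at the pairs [(g, h)] and [(g0, b)]. *)
have {}ysuml (I : {set P}) h : (#|I| < t + t)%N -> \sum_g y (I :|: [set (g, h)]) = y I.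
  have [-> _|I0] := eqVneq I set0; last exact: ysuml.
  rewrite [y set0]/y eqxx -(y_set1 g0).
  transitivity (\sum_g \sum_b y ([set (g, h)] :|: [set (g0, b)])).
    by apply: eq_bigr => g _; rewrite ysumr ?cards1 ?set0U //; lia.
  rewrite exchange_big; apply: eq_bigr => b _; under eq_bigr do rewrite setUC.
  rewrite ysuml ?cards1; [by []| |by lia].
  by apply/set0Pn; exists (g0, b); rewrite inE.
exists y; split.
(* The moment matrix is the congruence of [M] by the 0-1 matrix [Q] of the sets [U I]. A nonempty
   [I] is represented by one word; the empty set is represented by the constant words [(g0, h)],
   summed over [h]. *)
- pose U (I : {set P}) : {set {ffun 'I_t -> P}} :=
    if I == set0 then [set [ffun=> (g0, h)] | h : H]
    else if [pick w : {ffun 'I_t -> P} | wset w == I] is Some w then [set w]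
    else set0.
  have UE (I J : {set P}) : (#|I| <= t)%N -> (#|J| <= t)%N ->
      \sum_(u in U I) y (wset u :|: J) = y (I :|: J).
    move=> cI cJ; rewrite /U; have [->|I0] := eqVneq I set0.
      rewrite set0U big_imset /= => [|h h' _ _ /ffunP/(_ (Ordinal t_gt0))].
        rewrite -[RHS](ysumr J g0); last by lia.
        by apply: eq_bigr => h _; rewrite wset_const // setUC.
      by rewrite !ffunE => -[].
    case: pickP => [w /eqP wI|]; first by rewrite big_set1 wI.
    by have [w wI] := wset_surj I0 cI => /(_ w); rewrite wI eqxx.
  pose Q := \matrix_(i < #|[set I : {set P} | #|I| <= t]%N|, k < #|{ffun 'I_t -> P}|)
    ((enum_val k \in U (enum_val i))%:R : R).
  have := psdmx_congr Q psdM; congr psdmx.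
  apply/matrixP => i j; rewrite [RHS]mxE.
  have ci : (#|(enum_val i : {set P})| <= t)%N.
    by have := enum_valP i; rewrite inE.
  have cj : (#|(enum_val j : {set P})| <= t)%N.
    by have := enum_valP j; rewrite inE.
  rewrite setUC -UE // [LHS]mxE [RHS]big_mkcond /=.
  rewrite [RHS](reindex (@enum_val _ {ffun 'I_t -> P})) /=; last first.
    by exists enum_rank => w _; rewrite ?enum_rankK ?enum_valK.
  apply: eq_bigr => l _; rewrite [Q^T _ _]mxE [Q j _]mxE.
  case: ifP => _; rewrite ?mulr0 // mulr1.
  rewrite setUC -UE ?card_wset // [LHS]mxE [RHS]big_mkcond /=.
  rewrite [RHS](reindex (@enum_val _ {ffun 'I_t -> P})) /=; last first.
    by exists enum_rank => w _; rewrite ?enum_rankK ?enum_valK.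
  apply: eq_bigr => k _; rewrite [Q i _]mxE.
  case: ifP => _; rewrite ?mul0r // mul1r.
  by rewrite -wset_wcat yE /f wcatK wcatKr /mxat !enum_valK.
- by move=> I g cI; apply: ysumr; apply: leq_ltn_trans cI _; lia.
- by move=> I h cI; apply: ysuml; apply: leq_ltn_trans cI _; lia.
- move=> I cI npI; have [I0|I0] := eqVneq I set0.
    case: npI; exists 0%N, (fun=> g0), (fun=> h0).
    split; first by apply/forallP => -[].
    by rewrite I0; apply/setP => p; rewrite inE; apply/esym/negbTE/negP => /imsetP[[]].
  rewrite mul2n -addnn in cI; have [w wI] := wset_surj I0 cI.
  rewrite -{}wI in npI *; rewrite yE fE atp //; apply/negP => /same_atp_partial_iso.
  move=> pw; apply: npI; move: pw; congr partial_iso; congr wset.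
  by apply/ffunP => i; rewrite !ffunE -surjective_pairing.
- by rewrite /y eqxx.
Qed.

End LasserreIso.

(** * Kraus operators *)

Lemma trmxC_mul (C : numClosedFieldType) m n p (A : 'M[C]_(m, n)) (B : 'M[C]_(n, p)) :
  (A *m B)^t* = B^t* *m A^t*.
Proof. by rewrite trmx_mul map_mxM. Qed.

Lemma trmxCK (C : numClosedFieldType) m n (A : 'M[C]_(m, n)) : (A^t*)^t* = A.
Proof. by apply/matrixP => i j; rewrite !mxE conjCK. Qed.

Lemma trmxC_sum (C : numClosedFieldType) m n (I : finType) (F : I -> 'M[C]_(m, n)) :
  (\sum_i F i)^t* = \sum_i (F i)^t*.
Proof. by rewrite linear_sum /= raddf_sum. Qed.

Lemma trmxCB (C : numClosedFieldType) m n (A B : 'M[C]_(m, n)) :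
  (A - B)^t* = A^t* - B^t*.
Proof. by apply/matrixP => i j; rewrite !mxE rmorphB. Qed.

Lemma trmxC_real (R : realType) m n (A : 'M[R]_(m, n)) :
  (map_mx (real_complex R) A)^t* = map_mx (real_complex R) A^T.
Proof. by apply/matrixP => i j; rewrite !mxE; exact: conjc_real. Qed.

Lemma mxdotE (C : numClosedFieldType) n (A B : 'M[C]_n) :
  mxdot A B = \sum_i \sum_j A i j * (B i j)^*.
Proof. by apply: eq_bigr => i _; rewrite mxE; apply: eq_bigr => j _; rewrite !mxE. Qed.

Lemma mxdot_inj (C : numClosedFieldType) n (A B : 'M[C]_n) :
  (forall X, mxdot X A = mxdot X B) -> A = B.
Proof.
move=> AB; apply/matrixP => i j; apply: (inv_inj (@conjCK C)).
have dE (Y : 'M[C]_n) : mxdot (delta_mx i j) Y = (Y i j)^*.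
  rewrite mxdotE (bigD1 i) //= (bigD1 j) //= !mxE !eqxx mul1r.
  rewrite big1 => [|l /negPf nl]; last by rewrite mxE nl andbF mul0r.
  rewrite big1 => [|k /negPf nk]; first by rewrite !addr0.
  by rewrite big1 // => l _; rewrite mxE nk mul0r.
by rewrite -!dE.
Qed.

Lemma tr_mul_trmxC (C : numClosedFieldType) m n (A : 'M[C]_(m, n)) :
  \tr (A *m A^t*) = \sum_k \sum_l `|A k l| ^+ 2.
Proof.
by apply: eq_bigr => k _; rewrite mxE; apply: eq_bigr => l _; rewrite !mxE normCK.
Qed.

Lemma trmxC_mul_tr_eq0 (C : numClosedFieldType) m n (A : 'M[C]_(m, n)) :
  (\tr (A *m A^t*) = 0) -> A = 0.
Proof.
move=> trA; apply/matrixP => i j; rewrite mxE; apply/eqP.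
move/eqP: trA; rewrite tr_mul_trmxC psumr_eq0 => [/allP/(_ i (mem_index_enum i))|k _].
  rewrite /= psumr_eq0 => [/allP/(_ j (mem_index_enum j))|l _] /=.
    by rewrite sqrf_eq0 normr_eq0.
  by rewrite exprn_ge0.
by apply: sumr_ge0 => l _; rewrite exprn_ge0.
Qed.

Section Kraus.
Variables (C : numClosedFieldType) (k m n : nat).

Definition kraus (V : 'I_k -> 'M[C]_(n, m)) (X : 'M[C]_m) : 'M[C]_n :=
  \sum_s V s *m X *m (V s)^t*.

Fact kraus_is_linear V : linear (kraus V).
Proof.
move=> a X Y; rewrite /kraus scaler_sumr -big_split; apply: eq_bigr => s _ /=.
by rewrite mulmxDr mulmxDl -scalemxAr -scalemxAl.
Qed.

HB.instance Definition _ V :=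
  GRing.isLinear.Build C 'M[C]_m 'M[C]_n _ (kraus V) (kraus_is_linear V).

Lemma kraus_trmxC V X : kraus V (X^t*) = (kraus V X)^t*.
Proof.
by rewrite trmxC_sum; apply: eq_bigr => s _; rewrite !trmxC_mul trmxCK mulmxA.
Qed.

End Kraus.

Lemma mxdot_kraus (C : numClosedFieldType) k m n (V : 'I_k -> 'M[C]_(n, m)) X Y :
  mxdot (kraus V X) Y = mxdot X (kraus (fun s => (V s)^t*) Y).
Proof.
rewrite /mxdot /kraus mulmx_suml trmxC_sum mulmx_sumr !linear_sum /=.
apply: eq_bigr => s _; rewrite !trmxC_mul !trmxCK.
by rewrite -!mulmxA mxtrace_mulC !mulmxA.
Qed.

Lemma adjoint_kraus (C : numClosedFieldType) k m n (V : 'I_k -> 'M[C]_(n, m)) Y :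
  adjoint (kraus V) Y = kraus (fun s => (V s)^t*) Y.
Proof. by apply: mxdot_inj => X; rewrite -adjointP mxdot_kraus. Qed.

(* For a unital and trace-preserving [kraus V] both sides have the same norm:
   summing [|V_s X - X' V_s|^2] over [s] gives [|X|^2 - |X'|^2 = 0]. *)
Lemma kraus_intertwine (C : numClosedFieldType) k m n (V : 'I_k -> 'M[C]_(n, m))
    (W : 'I_k -> 'M[C]_(m, n)) X X' :
  (forall s, W s = (V s)^t*) -> kraus V 1%:M = 1%:M -> kraus W 1%:M = 1%:M ->
  kraus V X = X' -> kraus W X' = X -> forall s, V s *m X = X' *m V s.
Proof.
move=> WE V1 W1 VX WX'.
have WV Y : kraus W Y = kraus (fun s => (V s)^t*) Y.
  by apply: eq_bigr => s _; rewrite WE.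
have mxdot1 p (A : 'M[C]_p) : mxdot A 1%:M = \tr A.
  by rewrite /mxdot trmx1 map_mx1 mulmx1.
have XX' : mxdot X' X' = mxdot X X by rewrite -{1}VX mxdot_kraus -WV WX'.
pose D s := V s *m X - X' *m V s.
have DE : \sum_s \tr (D s *m (D s)^t*) = 0.
  (* Of the four sums in the expansion, the pure ones use that [kraus W] and [kraus V] fix the
     identity, the mixed ones that [kraus V X = X']. *)
  transitivity (mxdot X X - mxdot X' X' - mxdot X' X' + mxdot X' X').
    have -> : mxdot X X = \sum_s \tr (V s *m X *m (V s *m X)^t*).
      rewrite -[LHS]mxdot1 -W1 WV -mxdot_kraus mxdot1 linear_sum.
      by apply: eq_bigr => s _; rewrite trmxC_mul !mulmxA.
    have E1 : mxdot X' X' = \sum_s \tr (V s *m X *m (X' *m V s)^t*).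
      rewrite -{1}VX /mxdot mulmx_suml linear_sum.
      by apply: eq_bigr => s _; rewrite trmxC_mul !mulmxA.
    have E2 : mxdot X' X' = \sum_s \tr (X' *m V s *m (V s *m X)^t*).
      rewrite -{2}VX /mxdot -kraus_trmxC mulmx_sumr linear_sum.
      by apply: eq_bigr => s _; rewrite trmxC_mul !mulmxA.
    have E3 : mxdot X' X' = \sum_s \tr (X' *m V s *m (X' *m V s)^t*).
      rewrite /mxdot -{1}[X']mulmx1 -V1 mulmx_sumr mulmx_suml linear_sum.
      by apply: eq_bigr => s _; rewrite trmxC_mul mulmx1 !mulmxA.
    rewrite {1}E1 {1}E2 E3 -!sumrB -big_split; apply: eq_bigr => s _ /=.
    rewrite /D; move: (V s *m X) (X' *m V s) => A B.
    rewrite trmxCB mulmxBr !mulmxBl ![\tr (_ - _)]linearB /=; ring.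
  by rewrite XX' subrr sub0r addNr.
move=> s; apply/eqP; rewrite -subr_eq0; apply/eqP/trmxC_mul_tr_eq0/eqP.
have /eqP := DE; rewrite psumr_eq0 => [/allP/(_ s (mem_index_enum s))//|s' _].
rewrite tr_mul_trmxC sumr_ge0 // => i _; rewrite sumr_ge0 // => j _.
by rewrite exprn_ge0.
Qed.

(** * Partially coherent algebras *)

Lemma mxatP (C : Type) (T : finType) (A B : 'M[C]_#|T|) :
  (forall x y, mxat A x y = mxat B x y) -> A = B.
Proof.
move=> AB; apply/matrixP => i j.
by have := AB (enum_val i) (enum_val j); rewrite /mxat !enum_valK.
Qed.

Lemma sum_enum_val (V : nmodType) (T : finType) (f : 'I_#|T| -> V) :
  \sum_i f i = \sum_(x : T) f (enum_rank x).
Proof.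
rewrite (reindex (@enum_rank T)) //=.
by exists enum_val => x _; rewrite ?enum_rankK ?enum_valK.
Qed.

Lemma mxat_mul (C : pzRingType) (T : finType) (A B : 'M[C]_#|T|) x y :
  mxat (A *m B) x y = \sum_z mxat A x z * mxat B z y.
Proof. by rewrite /mxat mxE sum_enum_val. Qed.

Section WordEntries.
Variables (C : pzRingType) (t : nat) (G : graph).
Implicit Types (A B : tensor C t G) (w : {ffun 'I_(t + t) -> G}).

Definition wat A w : C := mxat A (wleft w) (wright w).

Lemma watP A B : (forall w, wat A w = wat B w) -> A = B.
Proof.
by move=> AB; apply: mxatP => x y; have := AB (wcat x y); rewrite /wat wcatK wcatKr.
Qed.

Lemma wat_wcat A x y : wat A (wcat x y) = mxat A x y.
Proof. by rewrite /wat wcatK wcatKr. Qed.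

Lemma wat_perm s A w : wat (tensor_perm s A) w = wat A (wperm s^-1%g w).
Proof. by rewrite /wat mxat_mxof wcat_split. Qed.

Lemma wat_schur A B w : wat (A \odot B) w = wat A w * wat B w.
Proof. by rewrite /wat /mxat mxE. Qed.

Lemma wat_const a w : wat (const_mx a) w = a.
Proof. by rewrite /wat /mxat mxE. Qed.

Lemma wat_homtensor (F : bigraph t) w : wat (homtensor C F G) w = (homcount F w)%:R.
Proof. by rewrite /wat homtensorE mxat_mxof wcat_split. Qed.

Lemma wat_mul A B x y :
  wat (A *m B) (wcat x y) = \sum_z wat A (wcat x z) * wat B (wcat z y).
Proof. by rewrite wat_wcat mxat_mul; under eq_bigr do rewrite -!wat_wcat. Qed.

Lemma homtensor_parallel (F A : bigraph t) :
  homtensor C (parallel F A) G = homtensor C A G \odot homtensor C F G.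
Proof.
by apply: watP => w; rewrite wat_schur !wat_homtensor homcount_parallel mulnC natrM.
Qed.

Lemma homtensor_series (F F' : bigraph t) :
  homtensor C (series F F') G = homtensor C F G *m homtensor C F' G.
Proof.
apply: watP => w; rewrite -(wcat_split w) wat_mul wat_homtensor homcount_series.
by rewrite natr_sum; apply: eq_bigr => z _; rewrite !wat_homtensor natrM.
Qed.

Lemma homtensor_perm (F : bigraph t) s :
  homtensor C (bigraph_perm F s) G = tensor_perm s (homtensor C F G).
Proof. by apply: watP => w; rewrite wat_perm !wat_homtensor homcount_perm. Qed.

Lemma homtensor_iso (F F' : bigraph t) :
  bigraph_iso F F' -> homtensor C F' G = homtensor C F G.
Proof.
by move=> FF'; apply: watP => w; rewrite !wat_homtensor (homcount_iso _ FF').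
Qed.

Definition id_bigraph : bigraph t :=
  atomic_of (fun i j => [exists k, (i == lshift t k) && (j == rshift t k)])
            (fun _ _ => false).

Lemma homcount_id (x y : {ffun 'I_t -> G}) : homcount id_bigraph (wcat x y) = (x == y).
Proof.
rewrite homcount_atomic_of; congr nat_of_bool.
apply/forallP/eqP => [h|<- i]; last first.
  apply/forallP => j; rewrite andbT; apply/implyP => /existsP[k /andP[/eqP-> /eqP->]].
  by rewrite wcatl wcatr.
apply/ffunP => k; have /andP[+ _] := forallP (h (lshift t k)) (rshift t k).
move/implyP; rewrite wcatl wcatr => /(_ _)/eqP-> //.
by apply/existsP; exists k; rewrite !eqxx.
Qed.

Lemma homtensor_id : homtensor C id_bigraph G = 1%:M.
Proof.
apply: mxatP => x y; rewrite -wat_wcat wat_homtensor homcount_id.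
by rewrite /mxat mxE (can_eq enum_rankK).
Qed.

End WordEntries.

Lemma mxdot_wat (C : numClosedFieldType) t (G : graph) (A B : tensor C t G) :
  mxdot A B = \sum_w wat A w * (wat B w)^*.
Proof.
rewrite mxdotE sum_words sum_enum_val; apply: eq_bigr => x _.
by rewrite sum_enum_val; apply: eq_bigr => y _; rewrite !wat_wcat.
Qed.

(** The entries of a homomorphism tensor are natural numbers, hence fixed by conjugation. *)
Lemma mxdot_schur_homtensor (C : numClosedFieldType) t (G : graph) (F : bigraph t)
    (A B : tensor C t G) :
  mxdot (homtensor C F G \odot A) B = mxdot A (homtensor C F G \odot B).
Proof.
rewrite !mxdot_wat; apply: eq_bigr => w _; rewrite !wat_schur rmorphM.
by rewrite wat_homtensor /= conjC_nat [RHS]mulrCA mulrA.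
Qed.

Lemma mxdot_tensor_perm (C : numClosedFieldType) t (G : graph) s
    (A B : tensor C t G) :
  mxdot (tensor_perm s A) B = mxdot A (tensor_perm s^-1%g B).
Proof.
rewrite !mxdot_wat (reindex (wperm s)) /=; last first.
  by exists (wperm s^-1%g) => w _; [exact: wpermK|exact: wpermKV].
by apply: eq_bigr => w _; rewrite !wat_perm wpermK invgK.
Qed.

Section Pcoh.
Variables (C : numClosedFieldType) (t : nat).

Lemma pcoh_algebra_sub (G : graph) (S : set (tensor C t G)) X :
  pcoh_closed S -> pcoh_algebra X -> S X.
Proof. by move=> clS; apply; split=> // ? []. Qed.

Lemma pcoh_algebra_closed (G : graph) : pcoh_closed (@pcoh_algebra C t G).
Proof.
split.
- move=> a M N hM hN S clS; apply: (pcoh_lin clS.1); [exact: hM|exact: hN].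
- move=> M N hM hN S clS; apply: (pcoh_mul clS.1); [exact: hM|exact: hN].
- move=> M hM S clS; apply: (pcoh_adj clS.1); exact: hM.
- move=> S clS; exact: (pcoh_I clS.1).
- move=> S clS; exact: (pcoh_J clS.1).
- move=> A M atA hM S clS; apply: (pcoh_schur clS.1) => //; exact: hM.
- move=> s M hM S clS; apply: (pcoh_perm clS.1); exact: hM.
Qed.

Lemma schurmx1 m n (A : 'M[C]_(m, n)) : A \odot const_mx 1 = A.
Proof. by apply/matrixP => i j; rewrite !mxE mulr1. Qed.

(** The algebraic conditions on an isomorphism map, isolated so that a map and its adjoint can be
    treated symmetrically. *)
Record structural (G H : graph) (Phi : tensor C t G -> tensor C t H) : Prop := {
  structural_schur : forall (A : bigraph t) X, atomic A ->
    Phi (homtensor C A G \odot X) = homtensor C A H \odot Phi X;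
  structural_J : Phi (const_mx 1) = const_mx 1;
  structural_perm : forall (s : 'S_(t + t)) X,
    Phi (tensor_perm s X) = tensor_perm s (Phi X) }.

Lemma structural_atomic (G H : graph) (Phi : tensor C t G -> tensor C t H) A :
  structural Phi -> atomic A -> Phi (homtensor C A G) = homtensor C A H.
Proof.
by move=> sPhi atA; rewrite -[homtensor C A G]schurmx1 (structural_schur sPhi) //
  (structural_J sPhi) schurmx1.
Qed.

(** The identity matrix is the tensor of an atomic graph. This supplies the unitality that
    [kraus_intertwine] requires. *)
Lemma structural_id (G H : graph) (Phi : tensor C t G -> tensor C t H) :
  structural Phi -> Phi 1%:M = 1%:M.
Proof.
by move=> sPhi; rewrite -!homtensor_id structural_atomic //; exact: atomic_atomic_of.
Qed.

Section TwoSided.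
Variables (G H : graph) (k : nat).
Variables (V : 'I_k -> 'M[C]_(#|{ffun 'I_t -> H}|, #|{ffun 'I_t -> G}|)).
Variables (W : 'I_k -> 'M[C]_(#|{ffun 'I_t -> G}|, #|{ffun 'I_t -> H}|)).
Hypothesis WE : forall s, W s = (V s)^t*.
Hypothesis sV : structural (kraus V).
Hypothesis sW : structural (kraus W).

(** The left factor is moved out of the Kraus sum by the intertwining relation
    [V s *m X = kraus V X *m V s]. *)
Lemma kraus_mull X Y : kraus W (kraus V X) = X ->
  kraus V (X *m Y) = kraus V X *m kraus V Y.
Proof.
move=> WVX; have VX := kraus_intertwine WE (structural_id sV) (structural_id sW)
  (erefl (kraus V X)) WVX.
rewrite {1 3}/kraus mulmx_sumr; apply: eq_bigr => s _.
by rewrite !mulmxA VX.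
Qed.

End TwoSided.

(** The matrices with image in the algebra of [H] that are fixed by the round trip form a closed set
    [S], which therefore contains the smallest one. *)
Lemma kraus_pcoh (G H : graph) k V W :
  (forall s : 'I_k, W s = (V s)^t*) -> structural (kraus V) -> structural (kraus W) ->
  forall X : tensor C t G, pcoh_algebra X ->
    pcoh_algebra (kraus V X : tensor C t H) /\ kraus W (kraus V X) = X.
Proof.
move=> WE sV sW.
have VE s : V s = (W s)^t* by rewrite WE trmxCK.
have clH := pcoh_algebra_closed H.
move=> X hX; pose S : set (tensor C t G) := fun X =>
  pcoh_algebra (kraus V X : tensor C t H) /\ kraus W (kraus V X) = X.
suff clS : pcoh_closed S by exact: (pcoh_algebra_sub clS hX).
split; rewrite /S {S}.
- move=> a M N [aM WM] [aN WN]; rewrite !linearP /= WM WN; split=> //.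
  exact: (pcoh_lin clH).
- move=> M N [aM WM] [aN WN].
  (* The product passes through [kraus V] and then, with the roles exchanged, back through
     [kraus W]. *)
  rewrite (kraus_mull WE) // (kraus_mull VE) ?WM ?WN //; split=> //.
  exact: (pcoh_mul clH).
- move=> M [aM WM]; rewrite !kraus_trmxC WM; split=> //; exact: (pcoh_adj clH).
- rewrite !structural_id //; split=> //; exact: (pcoh_I clH).
- rewrite !(structural_J sV, structural_J sW); split=> //; exact: (pcoh_J clH).
- move=> A M atA [aM WM]; rewrite (structural_schur sV) // (structural_schur sW) // WM.
  split=> //; exact: (pcoh_schur clH).
- move=> s M [aM WM]; rewrite (structural_perm sV) (structural_perm sW) WM.
  split=> //; exact: (pcoh_perm clH).
Qed.

(** Schur multiplication by a homomorphism tensor is self-adjoint and the adjoint of a permutation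
    is its inverse, so both identities pass to the adjoint map. *)
Lemma structural_kraus_adjoint (G H : graph) k V W :
  (forall s : 'I_k, W s = (V s)^t*) ->
  structural (kraus V : tensor C t G -> tensor C t H) ->
  kraus W (const_mx 1) = const_mx 1 ->
  structural (kraus W : tensor C t H -> tensor C t G).
Proof.
move=> WE sV WJ.
have WV Y : kraus W Y = kraus (fun s => (V s)^t*) Y.
  by apply: eq_bigr => s _; rewrite WE.
split=> // [A X atA|s X]; apply: mxdot_inj => Y; rewrite !WV.
  rewrite -mxdot_schur_homtensor -!mxdot_kraus (structural_schur sV) //.
  by rewrite mxdot_schur_homtensor.
rewrite -{2}[s]invgK -mxdot_tensor_perm -!mxdot_kraus (structural_perm sV).
by rewrite mxdot_tensor_perm invgK.
Qed.

End Pcoh.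

(** * Isomorphism maps *)

Section CompletelyPositive.
Variable R : realType.
Local Notation C := R[i].
Local Notation rc := (map_mx (real_complex R)).

Lemma id_tens_entry (m n : nat) (Phi : {linear 'M[C]_m -> 'M[C]_n}) r
    (X : 'M[C]_(r * m)) i j k l :
  id_tens Phi X (mxtens_index (i, k)) (mxtens_index (j, l))
  = Phi (\matrix_(k, l) X (mxtens_index (i, k)) (mxtens_index (j, l))) k l.
Proof.
rewrite /id_tens summxE (bigD1 i) //= summxE (bigD1 j) //= tensmxE mxE !eqxx mul1r.
rewrite big1 => [|j' /negPf nj]; last by rewrite tensmxE mxE eq_sym nj andbF mul0r.
rewrite big1 => [|i' /negPf ni]; first by rewrite !addr0.
by rewrite summxE big1 // => j' _; rewrite tensmxE mxE eq_sym ni mul0r.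
Qed.

Lemma id_tens_kraus (m n k r : nat) (V : 'I_k -> 'M[C]_(n, m)) (X : 'M[C]_(r * m)) :
  id_tens (kraus V) X
  = \sum_s ((1%:M : 'M_r) *t V s) *m X *m ((1%:M : 'M_r) *t V s)^t*.
Proof.
pose blk i j := \matrix_(k, l) X (mxtens_index (i, k)) (mxtens_index (j, l)).
have XE : X = \sum_i \sum_j (delta_mx i j : 'M_r) *t blk i j.
  apply/matrixP => p q; case: (mxtens_indexP p) => i a; case: (mxtens_indexP q) => j b.
  rewrite summxE (bigD1 i) //= summxE (bigD1 j) //= tensmxE !mxE !eqxx mul1r.
  rewrite big1 => [|j' /negPf nj]; last by rewrite tensmxE mxE eq_sym nj andbF mul0r.
  rewrite big1 => [|i' /negPf ni]; first by rewrite !addr0.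
  by rewrite summxE big1 // => j' _; rewrite tensmxE mxE eq_sym ni mul0r.
have tE (A : 'M[C]_r) (B : 'M[C]_m) s :
    ((1%:M : 'M_r) *t V s) *m (A *t B) *m ((1%:M : 'M_r) *t V s)^t*
    = A *t (V s *m B *m (V s)^t*).
  rewrite trmx_tens map_mxT trmx1 map_mx1 !tensmx_mul mul1mx mulmx1 //.
rewrite {2}XE /id_tens.
under [RHS]eq_bigr => s _.
  rewrite mulmx_sumr mulmx_suml; under eq_bigr => i _.
    rewrite mulmx_sumr mulmx_suml; under eq_bigr => j _ do rewrite tE.
  over.
over.
rewrite [RHS]exchange_big; apply: eq_bigr => i _ /=.
rewrite [RHS]exchange_big; apply: eq_bigr => j _ /=.
rewrite /kraus; apply/matrixP => p q.
case: (mxtens_indexP p) => a c; case: (mxtens_indexP q) => b d.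
rewrite tensmxE !summxE mulr_sumr; apply: eq_bigr => s _.
by rewrite tensmxE.
Qed.

(** With real operators the amplified map is a sum of real congruences. *)
Lemma kraus_completely_preserving (m n k : nat) (V : 'I_k -> 'M[R]_(n, m)) :
  completely_preserving (PSD R) (kraus (fun s => rc (V s))).
Proof.
move=> r _ [X psdX ->]; pose U s := (1%:M : 'M[R]_r) *t V s.
exists (\sum_s U s *m X *m (U s)^T).
  by apply: psdmx_sum => s; exact: psdmx_congr.
rewrite id_tens_kraus raddf_sum; apply: eq_bigr => s _ /=.
by rewrite !map_mxM -trmxC_real map_mxT map_mx1.
Qed.

(* Choi: [id (x) Phi] maps the real positive semidefinite matrix
   [sum_ij E_ij (x) E_ij] to [sum_ij E_ij (x) Phi E_ij]. *)
Lemma completely_preserving_kraus (m n : nat) (Phi : {linear 'M[C]_m -> 'M[C]_n}) :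
  completely_preserving (PSD R) Phi ->
  exists k (V : 'I_k -> 'M[R]_(n, m)), Phi =1 kraus (fun s => rc (V s)).
Proof.
move=> cpPhi.
(* The vectorised identity matrix: block [(i, j)] of [v^T *m v] is [delta_mx i j]. *)
pose v : 'rV[R]_(m * m) :=
  \row_p ((mxtens_unindex p).1 == (mxtens_unindex p).2)%:R.
have [|N /psdmx_factor[k [B ->]] PhiN] := cpPhi m (rc (v^T *m v)).
  by exists (v^T *m v) => //; exact: psdmx_gram.
(* Each row of the factor [B] of the Choi matrix, reshaped, is a Kraus operator. *)
exists k, (fun s => \matrix_(a, i) B s (mxtens_index (i, a))).
set V := (X in kraus X).
have PhiE i j : Phi (delta_mx i j) = kraus V (delta_mx i j).
  apply/matrixP => a b; have := id_tens_entry Phi (rc (v^T *m v)) i j a b.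
  rewrite (_ : \matrix_(_, _) _ = delta_mx i j); last first.
    apply/matrixP => c d; rewrite !mxE big_ord1 !mxE !mxtens_indexK /=.
    by rewrite -natrM mulnb rmorph_nat eq_sym [j == d]eq_sym.
  move=> <-; rewrite PhiN !mxE rmorph_sum summxE; apply: eq_bigr => s _ /=.
  rewrite !mxE (bigD1 j) //= !mxE (bigD1 i) //= !mxE !eqxx mulr1.
  rewrite big1 => [|i' /negPf ni]; last by rewrite !mxE ni mulr0.
  rewrite addr0 big1 => [|j' /negPf nj]; last first.
    by rewrite !mxE big1 ?mul0r // => i' _; rewrite !mxE nj andbF mulr0.
  by rewrite addr0 rmorphM; congr (_ * _); apply/esym; exact: conjc_real.
move=> X; rewrite [X]matrix_sum_delta !linear_sum; apply: eq_bigr => i _.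
by rewrite !linear_sum; apply: eq_bigr => j _; rewrite !linearZ /= PhiE.
Qed.

End CompletelyPositive.

Definition zipw (G H : finType) n (g : {ffun 'I_n -> G}) (h : {ffun 'I_n -> H}) :
  {ffun 'I_n -> (G * H)%type} := [ffun i => (g i, h i)].

Lemma zipw_wcat (G H : finType) t (g g' : {ffun 'I_t -> G}) (h h' : {ffun 'I_t -> H}) :
  zipw (wcat g g') (wcat h h') = wcat (zipw g h) (zipw g' h').
Proof.
apply/ffunP => i; rewrite -(splitK i); case: fintype.split => j /=;
by rewrite ?wcatl ?wcatr !ffunE -?[lshift _ _]/(unsplit (inl j))
  -?[rshift _ _]/(unsplit (inr j)) !unsplitK.
Qed.

Section IsoMaps.
Variables (R : realType) (t : nat) (G H : graph).

Lemma isomorphism_map_kraus (Phi : {linear tensor R[i] t G -> tensor R[i] t H}) :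
  isomorphism_map (PSD R) Phi ->
  exists k (V : 'I_k -> 'M[R[i]]_(#|{ffun 'I_t -> H}|, #|{ffun 'I_t -> G}|)),
    structural (kraus V) /\ structural (kraus (fun s => (V s)^t*)).
Proof.
case=> /completely_preserving_kraus[k [V PhiV]] schur J adjJ perm.
pose W s := map_mx (real_complex R) (V s); exists k, W.
have sW : structural (kraus W).
  by split=> [A X atA||s X]; rewrite -!PhiV // (schur, perm).
split=> //; apply: (structural_kraus_adjoint (V := W)) => //.
rewrite -adjoint_kraus -[RHS]adjJ; apply/matrixP => i j.
by rewrite !mxE PhiV.
Qed.

Lemma isomorphism_map_partially_equivalent
    (Phi : {linear tensor R[i] t G -> tensor R[i] t H}) :
  (0 < t)%N -> isomorphism_map (PSD R) Phi -> partially_equivalent R[i] t G H.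
Proof.
move=> t_gt0 /isomorphism_map_kraus[k [V []]].
pose W s := (V s)^t*; rewrite -/W => sV sW.
have WE s : W s = (V s)^t* by [].
have VE s : V s = (W s)^t* by rewrite trmxCK.
split.
  (* Both maps fix the identity, so adjointness compares the traces of the two identities:
     [#|H| ^ t = #|G| ^ t], and [t] is positive. *)
  have WV Y : kraus W Y = kraus (fun s => (V s)^t*) Y by [].
  have := mxdot_kraus V 1%:M 1%:M; rewrite -WV !structural_id //.
  rewrite /mxdot !trmx1 !map_mx1 !mulmx1 !mxtrace1 => /eqP.
  rewrite eqr_nat !card_ffun !card_ord => /eqP.
  by case: t t_gt0 => // n _ /eqP; rewrite eqn_exp2r // => /eqP ->.
have VP := kraus_pcoh WE sV sW; have WP := kraus_pcoh VE sW sV.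
exists (kraus V); split.
- split.
  + by move=> X /VP[].
  + by move=> X Y /set_mem/VP[_ WX] /set_mem/VP[_ WY] e; rewrite -WX e WY.
  + by move=> Y /WP[WY VY]; exists (kraus W Y).
- by move=> a M N _ _; exact: linearP.
- by move=> M _; exact: kraus_trmxC.
- by move=> M N /VP[_ WM] _; exact: (kraus_mull WE sV sW).
- exact: structural_id.
- by move=> A atA; exact: structural_atomic.
- exact: structural_J sV.
- by move=> A M atA _; exact: (structural_schur sV).
- by move=> s M _; exact: (structural_perm sV).
Qed.

Lemma level_isomorphic_isomorphism_map :
  level_isomorphic (PSD R) t G H ->
  exists Phi : {linear tensor R[i] t G -> tensor R[i] t H}, isomorphism_map (PSD R) Phi.
Proof.
move=> /level_isomorphic_PSD[M [/psdmx_factor[k [B MB]] isoM]].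
case: isoM => [_ suml sumr atp perm].
(* Rows of [B] are indexed by words of pairs; each is reshaped into a matrix from words over [G] to
   words over [H]. *)
pose V0 s : 'M[R]_(#|{ffun 'I_t -> H}|, #|{ffun 'I_t -> G}|) :=
  \matrix_(i, j) B s (enum_rank (zipw (enum_val j) (enum_val i))).
pose V s := map_mx (real_complex R) (V0 s).
(* On words of length [2t] the map has kernel [entry M]. Its marginals, its vanishing on unequal
   types and its symmetry then give the conditions on [Phi]. *)
have VE X w : wat (kraus V X : tensor R[i] t H) w
    = \sum_g real_complex R (entry M g w) * wat X g.
  rewrite -(wcat_split w); move: (wleft w) (wright w) => h h'.
  rewrite sum_words wat_wcat /mxat summxE.
  transitivity (\sum_s \sum_g \sum_g' real_complex R (B s (enum_rank (zipw g h)))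
      * real_complex R (B s (enum_rank (zipw g' h'))) * mxat X g g').
    apply: eq_bigr => s _; rewrite mxE sum_enum_val exchange_big /=.
    apply: eq_bigr => g' _; rewrite mxE sum_enum_val mulr_suml.
    apply: eq_bigr => g _; rewrite !mxE !enum_rankK.
    rewrite [X in _ * X](_ : _ = real_complex R (B s (enum_rank (zipw g' h')))).
      by rewrite mulrAC.
    exact: conjc_real.
  rewrite exchange_big; apply: eq_bigr => g _ /=.
  rewrite exchange_big; apply: eq_bigr => g' _ /=.
  rewrite wat_wcat -mulr_suml; congr (_ * _).
  rewrite /entry -/(zipw _ _) zipw_wcat wcatK wcatKr /mxat MB mxE rmorph_sum.
  by apply: eq_bigr => s _; rewrite mxE rmorphM.
have VJ : kraus V (const_mx 1) = const_mx 1.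
  apply: watP => w; rewrite VE wat_const -[RHS](rmorph1 (real_complex R)) -(suml w).
  by rewrite rmorph_sum; apply: eq_bigr => g _; rewrite wat_const mulr1.
exists (kraus V); split.
- exact: kraus_completely_preserving.
- move=> A X atA; apply: watP => w; rewrite wat_schur !VE mulr_sumr.
  apply: eq_bigr => g _; rewrite wat_schur mulrCA !wat_homtensor.
  have [gw|/atp->] := boolP (same_atp g w); last by rewrite !rmorph0 !mul0r !mulr0.
  by rewrite (homcount_atomic_atp atA gw).
- exact: VJ.
- apply: mxdot_inj => X; rewrite -adjointP !mxdot_wat.
  under eq_bigr => w _ do rewrite VE wat_const conjC1 mulr1.
  rewrite exchange_big; apply: eq_bigr => g _ /=.
  rewrite -mulr_suml -rmorph_sum sumr rmorph1 mul1r.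
  by rewrite wat_const conjC1 mulr1.
- move=> s X; apply: watP => w; rewrite wat_perm !VE.
  rewrite (reindex (wperm s)) /=; last first.
    by exists (wperm s^-1%g) => g _; [exact: wpermK|exact: wpermKV].
  apply: eq_bigr => g _; rewrite wat_perm wpermK; congr (real_complex R _ * _).
  by rewrite (perm _ _ s^-1%g) wpermK.
Qed.

End IsoMaps.

(** * Homomorphism indistinguishability *)

Lemma pcoh_iso_homtensor (C : numClosedFieldType) t (G H : graph)
    (phi : tensor C t G -> tensor C t H) (F : bigraph t) :
  pcoh_iso phi -> Lclass F ->
  pcoh_algebra (homtensor C F G) /\ phi (homtensor C F G) = homtensor C F H.
Proof.
move=> isophi; have clG := @pcoh_algebra_closed C t G.
elim=> {F} [F atF|F A _ [aF pF] atA|F F' _ [aF pF] _ [aF' pF']|F s _ [aF pF]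
           |F F' isoF _ [aF pF]].
- split; last exact: (pcoh_iso_A isophi).
  rewrite -[homtensor C F G]schurmx1.
  by apply: (pcoh_schur clG) => //; exact: (pcoh_J clG).
- rewrite !homtensor_parallel (pcoh_iso_schur isophi) // pF; split=> //.
  exact: (pcoh_schur clG).
- rewrite !homtensor_series (pcoh_iso_mul isophi) // pF pF'; split=> //.
  exact: (pcoh_mul clG).
- rewrite !homtensor_perm (pcoh_iso_perm isophi) // pF; split=> //.
  exact: (pcoh_perm clG).
- by rewrite !(homtensor_iso _ _ isoF).
Qed.

(** Brings the sum of all entries, hence a homomorphism count, into the algebra as a multiple of the
    all-ones matrix. *)
Lemma mul_const_mx1 (C : pzRingType) t (G : graph) (A : tensor C t G) :
  const_mx 1 *m A *m const_mx 1 = (\sum_w wat A w) *: const_mx 1 :> tensor C t G.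
Proof.
apply: mxatP => x y; rewrite mxat_mul sum_words [RHS]mxE [X in _ * X]mxE mulr1.
rewrite exchange_big; apply: eq_bigr => z _ /=; rewrite /mxat [X in _ * X]mxE mulr1.
rewrite -/(mxat _ _ _) mxat_mul; apply: eq_bigr => z' _.
by rewrite /mxat [X in X * _]mxE mul1r wat_wcat.
Qed.

Lemma sum_homtensor (C : pzRingType) t (G : graph) (F : bigraph t) :
  \sum_w wat (homtensor C F G) w = (Defs.hom F G)%:R.
Proof.
rewrite -sum_homcount natr_sum; apply: eq_bigr => w _.
by rewrite wat_homtensor.
Qed.

Lemma partially_equivalent_hom_indist (C : numClosedFieldType) t (G H : graph) :
  (0 < #|H|)%N -> partially_equivalent C t G H -> hom_indist t G H.
Proof.
move=> /card_gt0P[h0 _] [_ [phi isophi]] F LF.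
have [aF pF] := pcoh_iso_homtensor isophi LF.
have clG := @pcoh_algebra_closed C t G.
have aJ := pcoh_J clG.
have a0 : pcoh_algebra (0 : tensor C t G).
  by rewrite -(addNr (const_mx 1)) -scaleN1r; exact: (pcoh_lin clG).
have phi0 : phi 0 = 0.
  rewrite -(addNr (const_mx 1)) -scaleN1r (pcoh_iso_lin isophi) //.
  by rewrite scaleN1r addNr.
have aJF : pcoh_algebra (const_mx 1 *m homtensor C F G) by exact: (pcoh_mul clG).
have : phi (const_mx 1 *m homtensor C F G *m const_mx 1)
     = const_mx 1 *m homtensor C F H *m const_mx 1.
  by rewrite !(pcoh_iso_mul isophi) // (pcoh_iso_J isophi) pF.
rewrite !mul_const_mx1 !sum_homtensor -[X in phi X]addr0 (pcoh_iso_lin isophi) //.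
rewrite phi0 addr0 (pcoh_iso_J isophi).
(* A nonempty [H] provides an entry at which the scalars can be compared. *)
move=> /(congr1 (fun A : tensor C t H => mxat A [ffun=> h0] [ffun=> h0])).
by rewrite /mxat !mxE !mulr1 => /eqP; rewrite eqr_nat => /eqP.
Qed.

(** * Operations on the class [L_t] *)

Section Lclass.
Variable t : nat.

(* The linear maps on homomorphism counts, given by kernels uniform in the
   graph, that can be realised by an operation under which [L_t] is closed. *)
Definition realizable
    (K : forall G : graph, {ffun 'I_(t + t) -> G} -> {ffun 'I_(t + t) -> G} -> nat) :=
  forall F : bigraph t, Lclass F -> exists2 F', Lclass F' &
    forall (G : graph) (w : {ffun 'I_(t + t) -> G}),
      homcount F' w = (\sum_w' homcount F w' * K G w' w)%N.

Lemma realizable_diag (A : bigraph t) : atomic A ->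
  realizable (fun G w' w => (w' == w) * homcount A w)%N.
Proof.
move=> atA F LF; exists (parallel F A); first exact: Lclass_parallel.
move=> G w; rewrite homcount_parallel (bigD1 w) //= eqxx mul1n big1 ?addn0 //.
by move=> w' /negPf->; rewrite mul0n muln0.
Qed.

Lemma realizable_perm (s : 'S_(t + t)) :
  realizable (fun G w' w => (w' == wperm s w) : nat).
Proof.
move=> F LF; exists (bigraph_perm F s^-1%g); first exact: Lclass_perm.
move=> G w; rewrite homcount_perm invgK (bigD1 (wperm s w)) //= eqxx muln1.
rewrite big1 ?addn0 //.
by move=> w' /negPf->; rewrite muln0.
Qed.

Lemma realizable_mull (A : bigraph t) : Lclass A ->
  realizable (fun G w' w =>
    homcount A (wcat (wleft w) (wleft w')) * (wright w' == wright w))%N.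
Proof.
move=> LA F LF; exists (series A F); first exact: Lclass_series.
move=> G w; rewrite -{1}(wcat_split w) homcount_series sum_words.
apply: eq_bigr => z _; rewrite (bigD1 (wright w)) //= wcatK wcatKr eqxx muln1 mulnC.
rewrite big1 ?addr0 // => z' /negPf nz.
by rewrite wcatKr nz !muln0.
Qed.

Lemma realizable_mulr (A : bigraph t) : Lclass A ->
  realizable (fun G w' w =>
    (wleft w' == wleft w) * homcount A (wcat (wright w') (wright w)))%N.
Proof.
move=> LA F LF; exists (series F A); first exact: Lclass_series.
move=> G w; rewrite -{1}(wcat_split w) homcount_series sum_words.
rewrite [RHS](bigD1 (wleft w)) //= [X in _ + X]big1 ?addr0 => [|x /negPf nx].
  by apply: eq_bigr => z _; rewrite wcatK wcatKr eqxx mul1n.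
by rewrite big1 // => z _; rewrite wcatK nx muln0.
Qed.

Definition id_but_bigraph (j : 'I_t) : bigraph t :=
  atomic_of (fun a b => [exists k, [&& k != j, a == lshift t k & b == rshift t k]])
            (fun _ _ => false).

Lemma homcount_id_but j (G : graph) (x y : {ffun 'I_t -> G}) :
  homcount (id_but_bigraph j) (wcat x y) = [forall k, (k != j) ==> (x k == y k)].
Proof.
rewrite homcount_atomic_of; congr nat_of_bool.
apply/forallP/forallP => [h k|h a]; last first.
  apply/forallP => b; rewrite andbT; apply/implyP.
  move=> /existsP[k /and3P[kj /eqP-> /eqP->]].
  by rewrite wcatl wcatr; exact: (implyP (h k)).
apply/implyP => kj; have /andP[+ _] := forallP (h (lshift t k)) (rshift t k).
move/implyP; rewrite wcatl wcatr; apply.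
by apply/existsP; exists k; rewrite kj !eqxx.
Qed.

(* Summation over one label is a series composition with the atomic graph that
   identifies all other in-labels with the corresponding out-labels. *)
Lemma realizable_sum (i : 'I_(t + t)) :
  realizable (fun G w' w => [forall j, (j != i) ==> (w' j == w j)] : nat).
Proof.
have ext K K' : (forall G w' w, K G w' w = K' G w' w) -> realizable K -> realizable K'.
  move=> KK' rK F /rK[F' LF' F'E]; exists F' => // G w; rewrite F'E.
  by apply: eq_bigr => w' _; rewrite KK'.
have Lid j := Lclass_atomic (@atomic_atomic_of t
  (fun a b => [exists k, [&& k != j, a == lshift t k & b == rshift t k]])
  (fun _ _ => false)).
rewrite -(splitK i); case: fintype.split => j /=.
  apply: ext (realizable_mull (Lid j)) => G w' w.
  rewrite homcount_id_but mulnb; congr nat_of_bool.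
  apply/andP/forallP => [[/forallP ew /eqP/ffunP er] l|ew].
    rewrite -(splitK l); case: fintype.split => k /=.
      by have := ew k; rewrite (inj_eq (@lshift_inj _ _)) !ffunE [w _ == _]eq_sym.
    by have := er k; rewrite !ffunE => ->; rewrite eqxx implybT.
  split.
    apply/forallP => k; have := ew (lshift t k).
    by rewrite (inj_eq (@lshift_inj _ _)) !ffunE [w' _ == _]eq_sym.
  apply/eqP/ffunP => k; have := ew (rshift t k).
  by rewrite eq_rlshift !ffunE => /eqP.
apply: ext (realizable_mulr (Lid j)) => G w' w.
rewrite homcount_id_but mulnb; congr nat_of_bool.
apply/andP/forallP => [[/eqP/ffunP el /forallP ew] l|ew].
  rewrite -(splitK l); case: fintype.split => k /=.
    by have := el k; rewrite !ffunE => ->; rewrite eqxx implybT.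
  by have := ew k; rewrite (inj_eq (@rshift_inj _ _)) !ffunE.
split.
  apply/eqP/ffunP => k; have := ew (lshift t k).
  by rewrite eq_lrshift !ffunE => /eqP.
apply/forallP => k; have := ew (rshift t k).
by rewrite (inj_eq (@rshift_inj _ _)) !ffunE.
Qed.

(** Exchanges the halves of a word, so that transposing a tensor becomes an instance of the action
    of ['S_(t + t)]. *)
Definition swap_ord (i : 'I_(t + t)) : 'I_(t + t) :=
  match fintype.split i with inl j => rshift t j | inr j => lshift t j end.

Lemma swap_ordK : involutive swap_ord.
Proof.
by move=> i; rewrite -{2}(splitK i) /swap_ord; case: (fintype.split i) => j /=;
  rewrite -?[lshift _ _]/(unsplit (inl j)) -?[rshift _ _]/(unsplit (inr j)) unsplitK.
Qed.

Definition transpose_bigraph (F : bigraph t) :=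
  bigraph_perm F (perm (inv_inj swap_ordK)).

Lemma homcount_transpose (F : bigraph t) (G : graph) (x y : {ffun 'I_t -> G}) :
  homcount (transpose_bigraph F) (wcat x y) = homcount F (wcat y x).
Proof.
rewrite homcount_perm; congr homcount.
apply: (can_inj (wpermK (perm (inv_inj swap_ordK)))).
rewrite wpermKV; apply/ffunP => i; rewrite [RHS]ffunE permE -{1}(splitK i) /swap_ord.
by case: fintype.split => j /=; rewrite ?wcatl ?wcatr.
Qed.

(** The product with the transpose, restricted to its diagonal by [id_bigraph], sums to a trace: the
    inner product of the two tensors. *)
Lemma hom_transpose_series (F K : bigraph t) (G : graph) :
  Defs.hom (parallel (series F (transpose_bigraph K)) (id_bigraph t)) G
  = (\sum_(w : {ffun 'I_(t + t) -> G}) homcount F w * homcount K w)%N.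
Proof.
rewrite -sum_homcount !sum_words; apply: eq_bigr => x _.
rewrite (bigD1 x) //= big1 ?addr0 => [|y /negPf ny].
  rewrite homcount_parallel homcount_id eqxx muln1 homcount_series.
  by apply: eq_bigr => z _; rewrite homcount_transpose.
by rewrite homcount_parallel homcount_id eq_sym ny muln0.
Qed.

Lemma Lclass_transpose_series (F K : bigraph t) : Lclass F -> Lclass K ->
  Lclass (parallel (series F (transpose_bigraph K)) (id_bigraph t)).
Proof.
move=> LF LK; apply: Lclass_parallel; last exact: atomic_atomic_of.
by apply: Lclass_series => //; exact: Lclass_perm.
Qed.

End Lclass.

(** * Spans and Gram matrices of homomorphism tensors *)

Section HomMatrices.
Variables (R : realType) (t : nat).

Definition hommx (G : graph) k (X : 'I_k -> bigraph t) :
    'M[R]_(k, #|{ffun 'I_(t + t) -> G}|) :=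
  \matrix_(i, j) (homcount (X i) (enum_val j))%:R.

Lemma hommx_gram (G : graph) k l (X : 'I_k -> bigraph t) (Y : 'I_l -> bigraph t) i j :
  (hommx G X *m (hommx G Y)^T) i j
  = (Defs.hom (parallel (series (X i) (transpose_bigraph (Y j))) (id_bigraph t)) G)%:R.
Proof.
rewrite hom_transpose_series natr_sum mxE sum_enum_val; apply: eq_bigr => w _.
by rewrite !mxE enum_rankK natrM.
Qed.

(** A largest family in [L_t] with independent tensors; its size is bounded by the dimension of the
    tensor space. *)
Lemma hommx_basis (G : graph) : exists k (X : 'I_k -> bigraph t),
  [/\ forall i, Lclass (X i), row_free (hommx G X)
    & forall F, Lclass F -> (hommx G (fun _ : 'I_1 => F) <= hommx G X)%MS].
Proof.
pose P k := `[< exists X : 'I_k -> bigraph t,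
  (forall i, Lclass (X i)) /\ row_free (hommx G X) >].
have P0 : exists k, P k.
  exists 0%N; apply/asboolP.
  exists (fun=> id_bigraph t); split=> [[]//|].
  by rewrite /row_free -leqn0 rank_leq_row.
have Pbound k : P k -> (k <= #|{ffun 'I_(t + t) -> G}|)%N.
  by move=> /asboolP[X [_ /eqP<-]]; exact: rank_leq_col.
case: (ex_maxnP P0 Pbound) => k /asboolP[X [LX freeX]] maxk.
exists k, X; split=> // F LF; apply: contraT => notin.
pose Y (i : 'I_(1 + k)) := match fintype.split i with inl _ => F | inr j => X j end.
suff /maxk : P (1 + k)%N by rewrite ltnn.
apply/asboolP; exists Y; split=> [i|].
  by rewrite /Y; case: fintype.split.
have YE : hommx G Y = col_mx (hommx G (fun _ : 'I_1 => F)) (hommx G X).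
  by apply/matrixP => i j; rewrite !mxE /Y; case: fintype.split => a; rewrite mxE.
apply: inj_row_free => v; rewrite -(hsubmxK v) YE mul_row_col.
move: (lsubmx v) (rsubmx v) => a b ab.
have a0 : a = 0.
  apply/rowP => i; rewrite ord1 mxE; apply: contraNeq notin => a_neq0.
  have aE : a *m hommx G (fun _ : 'I_1 => F) = a 0 0 *: hommx G (fun _ : 'I_1 => F).
    by rewrite {1}[a]mx11_scalar mul_scalar_mx.
  apply/submxP; exists (- (a 0 0)^-1 *: b); rewrite -scalemxAl.
  move/eqP: ab; rewrite addrC addr_eq0 aE => /eqP->.
  by rewrite scaleNr scalerN opprK scalerA mulVf // scale1r.
move: ab; rewrite a0 mul0mx add0r => bX.
have -> : b = 0 by apply: (row_free_inj freeX); rewrite bX mul0mx.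
by rewrite row_mx0.
Qed.

End HomMatrices.

(** * The isometry between the spans and its matrix *)

Section IsoFromHom.
Variables (R : realType) (t : nat) (G H : graph).
Hypothesis indist : hom_indist t G H.

Lemma hommx_gram_indist k l (X : 'I_k -> bigraph t) (Y : 'I_l -> bigraph t) :
  (forall i, Lclass (X i)) -> (forall i, Lclass (Y i)) ->
  hommx R G X *m (hommx R G Y)^T = hommx R H X *m (hommx R H Y)^T.
Proof.
move=> LX LY; apply/matrixP => i j; rewrite !hommx_gram; congr (_%:R); apply: indist.
exact: Lclass_transpose_series.
Qed.

Variables (k : nat) (X : 'I_k -> bigraph t).
Hypothesis LX : forall i, Lclass (X i).
Hypothesis freeX : row_free (hommx R G X).
Hypothesis spanX :
  forall F, Lclass F -> (hommx R G (fun _ : 'I_1 => F) <= hommx R G X)%MS.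
Local Notation XG := (hommx R G X).
Local Notation XH := (hommx R H X).
Let Q := XG *m XG^T.

Let QH : XH *m XH^T = Q. Proof. by rewrite /Q hommx_gram_indist. Qed.

Let Qsym : Q^T = Q. Proof. by rewrite /Q trmx_mul trmxK. Qed.

(** A Gram matrix of independent real rows: [v *m Q = 0] makes the norm of [v *m XG] zero. *)
Let Qunit : Q \in unitmx.
Proof.
rewrite -row_free_unit; apply: inj_row_free => v vQ.
apply: (row_free_inj freeX); rewrite mul0mx; apply: row_sq_eq0.
by rewrite trmx_mul mulmxA -[v *m _ *m _]mulmxA vQ mul0mx mxE.
Qed.

(* The relation [F_G = sum c_i X_i,G] transfers to [H] because the norm of the
   difference of both sides is a combination of homomorphism counts. *)
Lemma hommx_transfer l (Y : 'I_l -> bigraph t) : (forall i, Lclass (Y i)) ->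
  exists c : 'M[R]_(l, k), hommx R G Y = c *m XG /\ hommx R H Y = c *m XH.
Proof.
move=> LY; have /submxP[c YE] : (hommx R G Y <= XG)%MS.
  apply/row_subP => i; have := spanX (LY i).
  by congr (_ <= _)%MS; apply/rowP => j; rewrite !mxE.
exists c; split=> //; apply/eqP; rewrite -subr_eq0; apply/eqP.
set D := _ - _.
have DD : D *m D^T = 0.
  have DE (A B : 'M[R]_(l, #|{ffun 'I_(t + t) -> H}|)) :
      (A - B) *m (A - B)^T = A *m A^T - A *m B^T - (B *m A^T - B *m B^T).
    by rewrite [(A - B)^T]linearB /= mulmxBl !mulmxBr.
  rewrite DE !trmx_mul !mulmxA -!(mulmxA c) -!hommx_gram_indist //.
  by rewrite !mulmxA -YE -!mulmxA -trmx_mul -YE !subrr.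
apply/row_matrixP => i; rewrite row0; apply: row_sq_eq0.
have := congr1 (fun A : 'M[R]_l => A i i) DD.
by rewrite !mxE => {2}<-; apply: eq_bigr => j _; rewrite !mxE.
Qed.

(** Acting on row vectors: the orthogonal projection onto the row space of [XG], followed by the map
    taking each row of [XG] to the same row of [XH]. *)
Definition isomx : 'M[R]_(_, _) := XG^T *m invmx Q *m XH.

Lemma hommx_isomx F : Lclass F ->
  hommx R G (fun _ : 'I_1 => F) *m isomx = hommx R H (fun _ : 'I_1 => F)
  /\ isomx *m (hommx R H (fun _ : 'I_1 => F))^T = (hommx R G (fun _ : 'I_1 => F))^T.
Proof.
move=> LF; have [c [-> ->]] := hommx_transfer (fun _ : 'I_1 => LF).
rewrite /isomx !trmx_mul !mulmxA; split.
  by rewrite -[c *m _ *m _]mulmxA -/Q -[c *m _ *m _]mulmxA mulmxV ?mulmx1.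
by rewrite -[_ *m XH *m _]mulmxA QH -[_ *m Q]mulmxA mulVmx ?mulmx1.
Qed.

Definition isoval (g : {ffun 'I_(t + t) -> G}) (h : {ffun 'I_(t + t) -> H}) : R :=
  isomx (enum_rank g) (enum_rank h).

(* If [XG L = C XG] and [XG L^T = C' XG], then [Q C'^T = XG L XG^T = C Q]. *)
Lemma isoval_realizable (K : forall G : graph,
    {ffun 'I_(t + t) -> G} -> {ffun 'I_(t + t) -> G} -> nat) g h :
  realizable K -> realizable (fun G w w' => K G w' w) ->
  \sum_g' (K G g g')%:R * isoval g' h = \sum_h' isoval g h' * (K H h' h)%:R.
Proof.
move=> rK rK'.
pose L (G : graph) : 'M[R]_#|{ffun 'I_(t + t) -> G}| :=
  \matrix_(i, j) (K G (enum_val i) (enum_val j))%:R.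
(* Realising the kernel on each [Y i] and expanding in the basis gives one coefficient matrix [C]
   that is valid for both graphs. *)
have mulL (Y : 'I_k -> bigraph t) (K0 : forall G : graph, _) :
    (forall i, Lclass (Y i)) -> realizable K0 -> exists C : 'M[R]_k,
    forall G0, G0 = G \/ G0 = H -> hommx R G0 Y *m (\matrix_(i, j)
       (K0 G0 (enum_val i) (enum_val j))%:R) = C *m hommx R G0 X.
  move=> LY rK0.
  have /choice[Z ZP] : forall i, exists F, Lclass F /\
      forall (G0 : graph) (w : {ffun 'I_(t + t) -> G0}),
        homcount F w = (\sum_w' homcount (Y i) w' * K0 G0 w' w)%N.
    by move=> i; have [F LF FE] := rK0 _ (LY i); exists F.
  have [C [CG CH]] := hommx_transfer (fun i => (ZP i).1).
  exists C => G0 G0E; transitivity (hommx R G0 Z); last by case: G0E => ->.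
  apply/matrixP => i j; rewrite !mxE sum_enum_val (ZP i).2 natr_sum.
  by apply: eq_bigr => w _; rewrite !mxE enum_rankK natrM.
have [C CE] := mulL X K LX rK; have [C' CE'] := mulL X _ LX rK'.
have CG : XG *m L G = C *m XG := CE G (or_introl erefl).
have CH : XH *m L H = C *m XH := CE H (or_intror erefl).
have CG' : XG *m (L G)^T = C' *m XG.
  rewrite -(CE' G (or_introl erefl)); congr (_ *m _).
  by apply/matrixP => i j; rewrite !mxE.
have QC : Q *m C'^T = C *m Q.
  by rewrite /Q mulmxA -CG -!mulmxA -trmx_mul -CG' trmx_mul trmxK.
have C'Q : C'^T *m invmx Q = invmx Q *m C.
  rewrite -[LHS]mul1mx -(mulVmx Qunit) -mulmxA (mulmxA Q) QC.
  by rewrite -(mulmxA C) mulmxV // mulmx1.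
have comm : L G *m isomx = isomx *m L H.
  rewrite /isomx -[RHS]mulmxA CH !mulmxA -[L G](trmxK) -trmx_mul CG' trmx_mul.
  by rewrite -(mulmxA _ C'^T) C'Q !mulmxA.
have := congr1 (fun A : 'M__ => A (enum_rank g) (enum_rank h)) comm.
rewrite [LHS]mxE [RHS]mxE !sum_enum_val; congr (_ = _); apply: eq_bigr => w _;
  by rewrite [L _ _ _]mxE !enum_rankK.
Qed.

Lemma isoval_atomic (A : bigraph t) g h : atomic A ->
  (homcount A g)%:R * isoval g h = isoval g h * (homcount A h)%:R.
Proof.
move=> atA; have rA := realizable_diag atA.
have rA' : realizable (fun (G : graph) (w w' : {ffun 'I_(t + t) -> G}) =>
    ((w' == w) * homcount A w)%N).
  move=> F /rA[F' LF' F'E]; exists F' => // G0 w; rewrite F'E.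
  by apply: eq_bigr => w' _; rewrite eq_sym; case: eqP => [->|].
have := isoval_realizable g h rA rA'.
rewrite (bigD1 g) //= eqxx mul1n big1 ?addr0 => [->|g' /negPf ng]; last first.
  by rewrite eq_sym ng mul0n mul0r.
rewrite (bigD1 h) //= eqxx mul1n big1 ?addr0 // => h' /negPf nh.
by rewrite nh mul0n mulr0.
Qed.

Lemma isoval_perm s g h : isoval g h = isoval (wperm s g) (wperm s h).
Proof.
have r' : realizable (fun (G : graph) (w w' : {ffun 'I_(t + t) -> G}) =>
    (w' == wperm s w) : nat).
  move=> F /(realizable_perm s^-1%g)[F' LF' F'E]; exists F' => // G0 w; rewrite F'E.
  by apply: eq_bigr => w' _; rewrite -(can_eq (wpermK s)) wpermKV eq_sym.
have := isoval_realizable (wperm s g) h (@realizable_perm t s) r'.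
rewrite (bigD1 g) //= eqxx mul1r big1 ?addr0 => [->|g' /negPf ng]; last first.
  by rewrite (can_eq (wpermK s)) eq_sym ng mul0r.
rewrite (bigD1 (wperm s h)) //= eqxx mulr1 big1 ?addr0 // => h' /negPf nh.
by rewrite nh mulr0.
Qed.

Lemma sum_agree (T : finType) n (g : {ffun 'I_n -> T}) i (f : {ffun 'I_n -> T} -> R) :
  \sum_(g' : {ffun 'I_n -> T})
    ([forall j, (j != i) ==> (g j == g' j)] : nat)%:R * f g'
  = \sum_a f (upd g i a).
Proof.
under eq_bigr do rewrite mulr_natl mulrb.
rewrite -big_mkcond /=.
rewrite (reindex_onto (fun a => upd g i a) (fun g' : {ffun 'I_n -> T} => g' i)) /=.
  apply: eq_bigl => a; rewrite ffunE eqxx eqxx andbT; apply/forallP => j.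
  by apply/implyP => /negPf ji; rewrite ffunE ji.
move=> g' /forallP gg'; apply/ffunP => j; rewrite ffunE.
by have [->//|ji] := eqVneq j i; have /implyP/(_ ji)/eqP := gg' j.
Qed.

(** The kernel relating words that agree off position [i] is symmetric, so it is its own transpose
    in [isoval_realizable]. *)
Lemma isoval_sum g h i :
  \sum_a isoval (upd g i a) h = \sum_b isoval g (upd h i b).
Proof.
have sym (G0 : graph) (w w' : {ffun 'I_(t + t) -> G0}) :
    [forall j, (j != i) ==> (w j == w' j)] = [forall j, (j != i) ==> (w' j == w j)].
  by apply: eq_forallb => j; rewrite [w j == _]eq_sym.
have r' : realizable (fun (G : graph) (w w' : {ffun 'I_(t + t) -> G}) =>
    [forall j, (j != i) ==> (w' j == w j)] : nat).
  move=> F /(realizable_sum i)[F' LF' F'E]; exists F' => // G0 w; rewrite F'E.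
  by apply: eq_bigr => w' _; rewrite sym.
have := isoval_realizable g h (@realizable_sum t i) r'.
rewrite sum_agree => ->; rewrite -sum_agree; apply: eq_bigr => w _.
by rewrite mulrC sym.
Qed.

(** [isoval_realizable] for left multiplication by [F], whose transposed kernel is left
    multiplication by [transpose_bigraph F]. *)
Lemma isoval_mull F x x' u u' : Lclass F ->
  \sum_z (homcount F (wcat z x))%:R * isoval (wcat z x') (wcat u u')
  = \sum_z isoval (wcat x x') (wcat z u') * (homcount F (wcat u z))%:R.
Proof.
move=> LF.
have LFT : Lclass (transpose_bigraph F) by exact: Lclass_perm.
have r' : realizable (fun (G : graph) (w w' : {ffun 'I_(t + t) -> G}) =>
    (homcount F (wcat (wleft w) (wleft w')) * (wright w' == wright w))%N).
  move=> K /(realizable_mull LFT)[F' LF' F'E]; exists F' => // G0 w; rewrite F'E.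
  by apply: eq_bigr => w' _; rewrite homcount_transpose eq_sym.
have := isoval_realizable (wcat x x') (wcat u u') (realizable_mull LF) r'.
rewrite !sum_words => e.
transitivity (\sum_z \sum_z' (homcount F (wcat (wleft (wcat z z')) (wleft (wcat x x')))
    * (wright (wcat x x') == wright (wcat z z')))%:R
    * isoval (wcat z z') (wcat u u')).
  apply: eq_bigr => z _; rewrite (bigD1 x') //= !wcatK !wcatKr eqxx muln1.
  rewrite big1 ?addr0 // => z' /negPf nz.
  by rewrite !wcatKr eq_sym nz muln0 mul0r.
rewrite e; apply: eq_bigr => z _; rewrite (bigD1 u') //= !wcatK !wcatKr eqxx muln1.
rewrite big1 ?addr0 // => z' /negPf nz.
by rewrite !wcatKr nz muln0 mulr0.
Qed.

(** The edgeless atomic graph with [2t] distinct labels has the all-ones tensor, which [isomx]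
    carries from [G] to [H]. *)
Lemma isoval_suml h : \sum_g isoval g h = 1.
Proof.
pose J : bigraph t := atomic_of (fun _ _ => false) (fun _ _ => false).
have JE (G0 : graph) : hommx R G0 (fun _ : 'I_1 => J) = const_mx 1.
  apply/matrixP => i j; rewrite !mxE homcount_atomic_of.
  by rewrite (introT forallP) // => a; apply/forallP.
have [JM _] := hommx_isomx (Lclass_atomic (@atomic_atomic_of t _ _) : Lclass J).
have := congr1 (fun A : 'M__ => A 0 (enum_rank h)) JM.
rewrite !JE [RHS]mxE => <-; rewrite [RHS]mxE sum_enum_val.
by apply: eq_bigr => g _; rewrite [const_mx _ _ _]mxE mul1r.
Qed.

Lemma isoval_sumr g : \sum_h isoval g h = 1.
Proof.
pose J : bigraph t := atomic_of (fun _ _ => false) (fun _ _ => false).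
have JE (G0 : graph) : hommx R G0 (fun _ : 'I_1 => J) = const_mx 1.
  apply/matrixP => i j; rewrite !mxE homcount_atomic_of.
  by rewrite (introT forallP) // => a; apply/forallP.
have [_ JM] := hommx_isomx (Lclass_atomic (@atomic_atomic_of t _ _) : Lclass J).
have := congr1 (fun A : 'M__ => A (enum_rank g) 0) JM.
rewrite !JE !trmx_const [RHS]mxE => <-; rewrite [RHS]mxE sum_enum_val.
by apply: eq_bigr => h _; rewrite [const_mx _ _ _]mxE mulr1.
Qed.

(** If the types differ, a single identification or a single edge between two label positions gives
    an atomic graph whose counts at [g] and [h] differ; [isoval_atomic] then forces zero. *)
Lemma isoval_atp (g : {ffun 'I_(t + t) -> G}) (h : {ffun 'I_(t + t) -> H}) :
  ~~ same_atp g h -> isoval g h = 0.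
Proof.
have zero (A : bigraph t) : atomic A -> homcount A g != homcount A h -> isoval g h = 0.
  move=> atA /negP nA; have /eqP := isoval_atomic g h atA.
  rewrite mulrC -subr_eq0 -mulrBr mulf_eq0 subr_eq0 eqr_nat => /orP[/eqP //|].
  by move/nA.
pose one i j : rel 'I_(t + t) := fun a b => (a == i) && (b == j).
have oneE (G0 : graph) (w : {ffun 'I_(t + t) -> G0}) i j (e : rel G0) :
    [forall a, forall b, one i j a b ==> e (w a) (w b)] = e (w i) (w j).
  apply/forallP/idP => [/(_ i)/forallP/(_ j)/implyP|eij a].
    by apply; rewrite /one !eqxx.
  by apply/forallP => b; apply/implyP => /andP[/eqP-> /eqP->].
have neqb (b c : bool) : ((b : nat) != c) = (b != c) by case: b c => [] [].
move=> /forallPn[i /forallPn[j]].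
rewrite negb_and => /orP[] nij.
  apply: (zero (atomic_of (one i j) (fun _ _ => false))).
    exact: atomic_atomic_of.
  have E (G0 : graph) (w : {ffun 'I_(t + t) -> G0}) :
      homcount (atomic_of (one i j) (fun _ _ => false)) w = (w i == w j).
    rewrite homcount_atomic_of -(oneE _ w i j (fun a b => a == b)); congr nat_of_bool.
    by apply: eq_forallb => a; apply: eq_forallb => b; rewrite andbT.
  by rewrite !E neqb.
apply: (zero (atomic_of (fun _ _ => false) (one i j))).
  exact: atomic_atomic_of.
have E (G0 : graph) (w : {ffun 'I_(t + t) -> G0}) :
    homcount (atomic_of (fun _ _ => false) (one i j)) w = edge (w i) (w j).
  rewrite homcount_atomic_of -(oneE _ w i j (@edge G0)); congr nat_of_bool.
by rewrite !E neqb.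
Qed.

Definition fstw n (w : {ffun 'I_n -> (G * H)%type}) : {ffun 'I_n -> G} :=
  [ffun i => (w i).1].
Definition sndw n (w : {ffun 'I_n -> (G * H)%type}) : {ffun 'I_n -> H} :=
  [ffun i => (w i).2].

(** The reshuffling of [isomx]: rows now carry the first halves of the words over [G] and over [H],
    columns the second halves. *)
Definition isotensor : 'M[R]_#|{ffun 'I_t -> (G * H)%type}| :=
  mxof (fun a b => isoval (fstw (wcat a b)) (sndw (wcat a b))).

Lemma isotensorE g g' h h' :
  mxat isotensor (zipw g h) (zipw g' h') = isoval (wcat g g') (wcat h h').
Proof.
rewrite mxat_mxof -zipw_wcat; congr isoval; apply/ffunP => i;
by rewrite [LHS]ffunE [zipw _ _ _]ffunE.
Qed.

Lemma entry_isotensor g h : entry isotensor g h = isoval g h.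
Proof.
rewrite /entry mxat_mxof wcat_split; congr isoval; apply/ffunP => i;
by rewrite !ffunE.
Qed.

Lemma iso_matrix_isotensor : iso_matrix isotensor.
Proof.
split=> [g h i|h|g|g h gh|g h s]; try (under eq_bigr do rewrite entry_isotensor).
- by under [RHS]eq_bigr do rewrite entry_isotensor; exact: isoval_sum.
- exact: isoval_suml.
- exact: isoval_sumr.
- by rewrite entry_isotensor isoval_atp.
- by rewrite !entry_isotensor -isoval_perm.
Qed.

Lemma sum_zipw n (f : {ffun 'I_n -> (G * H)%type} -> R) :
  \sum_a f a = \sum_x \sum_u f (zipw x u).
Proof.
rewrite pair_big /= (reindex (fun p : _ * _ => zipw p.1 p.2)) //=.
exists (fun w => (fstw w, sndw w)) => [[x u] _|w _] /=.
  by congr (_, _); apply/ffunP => i; rewrite !ffunE.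
by apply/ffunP => i; rewrite !ffunE -surjective_pairing.
Qed.

(** Transposing exchanges the halves of both words simultaneously, which is an instance of
    [isoval_perm]. *)
Lemma isotensor_sym : isotensor^T = isotensor.
Proof.
apply: mxatP => a b; rewrite /mxat mxE -/(mxat isotensor b a) -/(mxat isotensor a b).
rewrite !mxat_mxof (isoval_perm (perm (inv_inj (@swap_ordK t)))).
by congr isoval; apply/ffunP => i; rewrite [LHS]ffunE [in LHS]ffunE [RHS]ffunE permE;
  congr (fst _) || congr (snd _);
  rewrite -(splitK i) /swap_ord unsplitK; case: fintype.split => j /=;
  rewrite ?wcatl ?wcatr.
Qed.

(* [Y = z isotensor], read as a [G^t x H^t] matrix, intertwines all [F_G] and
   [F_H]; with [invmx Q = E E^T] the form [Y isotensor Y^T] is a sum of squares. *)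
Lemma isotensor_cube (z : 'rV[R]_#|{ffun 'I_t -> (G * H)%type}|) :
  0 <= (z *m isotensor *m isotensor *m (z *m isotensor)^T) 0 0.
Proof.
pose Y x u := (z *m isotensor) 0 (enum_rank (zipw x u)).
have YE x u : Y x u = \sum_x' \sum_u' isoval (wcat x x') (wcat u u')
    * z 0 (enum_rank (zipw x' u')).
  rewrite /Y -isotensor_sym mxE sum_enum_val sum_zipw.
  apply: eq_bigr => x' _; apply: eq_bigr => u' _.
  by rewrite mxE mulrC -isotensorE.
have Yint F x u : Lclass F ->
    \sum_v (homcount F (wcat v x))%:R * Y v u
    = \sum_v Y x v * (homcount F (wcat u v))%:R.
  move=> LF.
  under eq_bigr => v _ do (rewrite YE mulr_sumr;
    under eq_bigr => x' _ do rewrite mulr_sumr).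
  under [RHS]eq_bigr => v _ do (rewrite YE mulr_suml;
    under eq_bigr => x' _ do rewrite mulr_suml).
  rewrite exchange_big [RHS]exchange_big; apply: eq_bigr => x' _ /=.
  rewrite exchange_big [RHS]exchange_big; apply: eq_bigr => u' _ /=.
  under eq_bigr do rewrite mulrA.
  under [RHS]eq_bigr do rewrite mulrAC.
  by rewrite -!mulr_suml isoval_mull.
(* The witness works because [invmx Q *m Q *m invmx Q = invmx Q]. *)
have [E QE] : exists E : 'M_(k, #|{ffun 'I_(t + t) -> G}|), invmx Q = E *m E^T.
  exists (invmx Q *m XG).
  by rewrite trmx_mul trmx_inv Qsym -mulmxA (mulmxA XG) -/Q mulmxV // mulmx1.
pose KG s (g : {ffun 'I_(t + t) -> G}) : R := \sum_i E i s * (homcount (X i) g)%:R.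
pose KH s (h : {ffun 'I_(t + t) -> H}) : R := \sum_i E i s * (homcount (X i) h)%:R.
have isovalE g h : isoval g h = \sum_s KG s g * KH s h.
  have ME : isomx = (E^T *m XG)^T *m (E^T *m XH).
    by rewrite /isomx QE trmx_mul trmxK !mulmxA.
  rewrite /isoval ME mxE; apply: eq_bigr => s _; rewrite [_^T _ _]mxE.
  by congr (_ * _); rewrite mxE; apply: eq_bigr => i _; rewrite !mxE enum_rankK.
(* [KG s] and [KH s] are the same combination of tensors of graphs in [L_t], so [Y] intertwines them
   as well. *)
have Kint s x u :
    \sum_v KG s (wcat v x) * Y v u = \sum_v Y x v * KH s (wcat u v).
  under eq_bigr do rewrite mulr_suml.
  under [RHS]eq_bigr do rewrite mulr_sumr.
  rewrite exchange_big [RHS]exchange_big; apply: eq_bigr => i _ /=.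
  under eq_bigr do rewrite -mulrA.
  under [RHS]eq_bigr do rewrite mulrCA.
  by rewrite -!mulr_sumr Yint.
suff -> : (z *m isotensor *m isotensor *m (z *m isotensor)^T) 0 0
    = \sum_s \sum_u \sum_x' (\sum_x KG s (wcat x x') * Y x u) ^+ 2.
  by do 3 (apply: sumr_ge0 => ? _); exact: sqr_ge0.
transitivity (\sum_x \sum_u \sum_x' \sum_u'
    \sum_s Y x u * (KG s (wcat x x') * KH s (wcat u u')) * Y x' u').
  rewrite -[_ *m isotensor *m _]mulmxA mxE sum_enum_val sum_zipw.
  apply: eq_bigr => x _; apply: eq_bigr => u _.
  rewrite -/(Y x u) mxE sum_enum_val sum_zipw mulr_sumr.
  apply: eq_bigr => x' _; rewrite mulr_sumr; apply: eq_bigr => u' _.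
  rewrite [_^T _ _]mxE -/(Y x' u') -/(mxat _ _ _) isotensorE isovalE.
  by rewrite mulr_suml mulr_sumr; apply: eq_bigr => s _; rewrite mulrA.
rewrite exchange_big [RHS]exchange_big; apply: eq_bigr => u _ /=.
rewrite exchange_big [RHS]exchange_big; apply: eq_bigr => x' _ /=.
(* One factor of each square is rewritten over [H] by [Kint], which restores the product of [KG s]
   and [KH s]. *)
under [RHS]eq_bigr => s _ do rewrite expr2 {2}Kint big_distrlr /=.
rewrite [RHS]exchange_big; apply: eq_bigr => x _ /=.
rewrite [RHS]exchange_big; apply: eq_bigr => u' _ /=.
by apply: eq_bigr => s _; ring.
Qed.

End IsoFromHom.

Lemma hom_indist_level_isomorphic (R : realType) t (G H : graph) :
  hom_indist t G H -> level_isomorphic (PSD R) t G H.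
Proof.
move=> indist; apply/level_isomorphic_PSD.
have [k [X [LX freeX spanX]]] := hommx_basis R t G.
exists (@isotensor R t G H k X); split.
  apply: psdmx_cube; first exact: isotensor_sym.
  exact: isotensor_cube.
exact: iso_matrix_isotensor.
Qed.

Theorem theorem3p1 (R : realType) (t : nat) (G H : graph)
    (t_ge1 : (1 <= t)%N) (simpleG : simple G) (simpleH : simple H)
    (G_nonempty : (0 < #|G|)%N) (H_nonempty : (0 < #|H|)%N) :
  [<-> lasserre_feasible R t G H;
       level_isomorphic (PSD R) t G H;
       exists Phi : {linear tensor R[i] t G -> tensor R[i] t H},
         isomorphism_map (PSD R) Phi;
       partially_equivalent R[i] t G H;
       hom_indist t G H].
Proof.
split; first by move=> /(lasserre_level_isomorphic t_ge1); exact.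
split; first exact: level_isomorphic_isomorphism_map.
split; first by case=> Phi; exact: isomorphism_map_partially_equivalent.
split; first exact: partially_equivalent_hom_indist.
by move=> /(hom_indist_level_isomorphic R); exact: level_isomorphic_lasserre.
Qed.
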